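(* For all integers $g\ge 0$ and $n\ge 0$, \[ {\sf u}_{g+2}(n+2)={\sf t}_{g}(n)+{\sf d}_{g+2}(n)+4\,{\sf u}_{g+2}(n+1)-3\,{\sf u}_{g+2}(n)+(n+1)(2n+1)\,{\sf u}_{g+1}(n), \] where \[ {\sf d}_{g+2}(n)=3\sum_{g_1=0}^{g+1}\sum_{m=0}^{n}{\sf u}^{*}_{g_1}(m)\,{\sf b}_{g+1-g_1}(n-m) +\sum_{g_1,g_2}\ \sum_{m_1,m_2}{\sf u}^{*}_{g_1}(m_1)\,{\sf u}^{*}_{g_2}(m_2)\,{\sf u}^{*}_{g+2-g_1-g_2}(n-m_1-m_2), \] the second sum running over all integers $g_1,g_2\ge 0$ with $g_1+g_2\le g+2$ and all integers $m_1,m_2\ge 0$ with $m_1+m_2\le n$, and where ${\sf u}^{*}_{g}(n)=0$ if $g=0$ and $n=0$, and ${\sf u}^{*}_{g}(n)={\sf u}_{g}(n)$ otherwise.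
   Context: A $k$-cellular map is a triple $(H,\alpha,(\gamma_i)_{1\le i\le k})$ where $H$ is a finite set (of half-edges) of even cardinality, $\alpha$ is a fixed-point-free involution of $H$ (its 2-cycles are the edges), and $\gamma_1,\dots,\gamma_k$ are cycles with pairwise disjoint supports whose union is $H$ (the faces); put $\gamma=\prod_i\gamma_i$. The vertices are the cycles (including fixed points) of $\sigma=\alpha\circ\gamma$. The combinatorial graph has the vertices as vertices and the edges as edges, an edge joining the vertices containing its two half-edges. For a map with connected combinatorial graph, its genus $g$ is given by $2-2g=V-E+k$, with $V$ the number of vertices and $E$ the number of edges. A planted $k$-cellular map is one in which each face $\gamma_i$ contains a distinguished half-edge $p_i$ with $\sigma(p_i)=p_i$ (the plant of $\gamma_i$); the edges $\{p_i,\alpha(p_i)\}$ are plant edges and all other edges are $(np)$-edges. Maps are considered up to isomorphism (bijections of half-edge sets commuting with $\alpha$ and each $\gamma_i$ and preserving the plants). A planted unicellular map is a planted $1$-cellular map; ${\sf u}_g(n)$ denotes the number of planted unicellular maps of genus $g$ with $n$ $(np)$-edges (taken to be $0$ if $g<0$ or $n<0$). A planted bicellular (resp. tricellular) map is a planted $2$-cellular (resp. $3$-cellular) map whose combinatorial graph is connected; ${\sf b}_g(n)$ (resp. ${\sf t}_g(n)$) denotes the number of planted bicellular (resp. tricellular) maps of genus $g$ with $n$ $(np)$-edges. *)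

(* Defs.v *)
From mathcomp Require Import all_boot all_order all_fingroup all_algebra.
Set Implicit Arguments. Unset Strict Implicit. Unset Printing Implicit Defensive.
Import GRing.Theory Num.Theory.

(* A map with half-edge set 'I_N and k labelled faces:
   (alpha, gamma, plant).  gamma is the product of the face cycles; face i is
   the gamma-orbit of plant i (this labels the faces gamma_1..gamma_k). *)
Definition MD (N k : nat) :=
  ({perm 'I_N} * {perm 'I_N} * {ffun 'I_k -> 'I_N})%type.

Section Maps.
Variables (N k : nat).
Implicit Types M : MD N k.

Definition malpha M : {perm 'I_N} := M.1.1.
Definition mgamma M : {perm 'I_N} := M.1.2.
Definition mplant M : {ffun 'I_k -> 'I_N} := M.2.
(* sigma = alpha o gamma  (in MathComp, (s * t) x = t (s x)) *)
Definition msigma M : {perm 'I_N} := (mgamma M * malpha M)%g.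

Definition planted_cellular M : bool :=
  [forall h, malpha M (malpha M h) == h] &&
  [forall h, malpha M h != h] &&
  (#|porbits (mgamma M)| == k) &&
  [forall i, forall j, (i != j) ==>
      (porbit (mgamma M) (mplant M i) != porbit (mgamma M) (mplant M j))] &&
  [forall i, msigma M (mplant M i) == mplant M i].

Definition nverts M := #|porbits (msigma M)|.
Definition nedges M := #|porbits (malpha M)|.

Definition mconnected M : bool :=
  [forall x, forall y,
     connect (fun a b => (b == msigma M a) || (b == malpha M a)) x y].

Definition n_np_edges M : nat :=
  nedges M - #|[set porbit (malpha M) (mplant M i) | i : 'I_k]|.

Definition has_genus M (g : nat) : bool :=
  ((2%:Z - 2%:Z * g%:Z)%R == ((nverts M)%:Z - (nedges M)%:Z + k%:Z)%R).

Definition good (g n : nat) M : bool :=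
  [&& planted_cellular M, mconnected M, has_genus M g & n_np_edges M == n].

Definition iso M M' : bool :=
  [exists phi : {perm 'I_N},
     [forall h, phi (malpha M h) == malpha M' (phi h)] &&
     [forall h, phi (mgamma M h) == mgamma M' (phi h)] &&
     [forall i, phi (mplant M i) == mplant M' i]].

Definition classes (g n : nat) : {set {set MD N k}} :=
  [set [set M' | iso M M'] | M in [set M | good g n M]].
End Maps.

(* Number of planted connected k-cellular maps of genus g with n (np)-edges,
   up to isomorphism.  Any such map has at most n + k edges, so half-edge
   sets of size N <= 2(n+k) suffice; maps with different N are never
   isomorphic. *)
Definition count_maps (k g n : nat) : nat :=
  \sum_(N < (2 * (n + k)).+1) #|classes N k g n|.

Definition u (g n : nat) : nat := count_maps 1 g n.
Definition b (g n : nat) : nat := count_maps 2 g n.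
Definition t (g n : nat) : nat := count_maps 3 g n.

Definition ustar (g n : nat) : nat := if (g == 0) && (n == 0) then 0 else u g n.

Definition d2 (g n : nat) : nat :=
  3 * (\sum_(g1 < g.+2) \sum_(m < n.+1) ustar g1 m * b (g.+1 - g1) (n - m))
  + \sum_(g1 < g.+3) \sum_(g2 < g.+3 - g1) \sum_(m1 < n.+1) \sum_(m2 < n.+1 - m1)
      ustar g1 m1 * ustar g2 m2 * ustar (g.+2 - g1 - g2) (n - m1 - m2).

(* Main.v *)
(* Count maps with labelled half-edges, not necessarily connected, weighted by
   X^eta with 2 eta = E + k - V.  This statistic is additive over components and
   equals g + k - 1 on a connected map of genus g with k faces; planted maps
   have no automorphisms, so division by N! recovers isomorphism classes.

   Let h follow the plant edge {p, p'} of the first face, and h' = alpha(h).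
   Replacing gamma by gamma o (p' h') keeps alpha and turns h' into a fixed
   point of sigma.  Either h = p and the face is a component of its own, or h'
   lies in the same face, which is split into two faces planted at p and h', or
   h' lies in another face, and the two faces are merged.  Writing U, W2, W3 for
   the generating functions of possibly disconnected maps with 1, 2, 3 faces,
     U(n+1) = W2(n),
     W2(n+1) = U(n+1) + W3(n) + (n+1)(2n+1) X U(n),
   where the last coefficient counts the positions of two unordered leaves in a
   unicellular map.  Expanding W2 and W3 over components and isolating the
   components without (np)-edges gives the recursion. *)
Require Import Defs.
From mathcomp Require Import all_boot all_order all_fingroup all_algebra.
From mathcomp Require Import zify ring.
Import GRing.Theory Num.Theory.
Local Open Scope ring_scope.
Set Implicit Arguments. Unset Strict Implicit. Unset Printing Implicit Defensive.

(** * Cycles of permutations and the genus inequality *)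

Section Cycles.
Local Open Scope group_scope.
Variable T : finType.
Implicit Types (s a : {perm T}) (x y z : T).

(** Merging two faces turns the plant of the second face and h' into leaves of a unicellular map. In
    the walk around its face from p' the former precedes the latter, and any two leaves in this
    order arise, so merges count half of the ordered pairs of distinct leaves. These pairs are
    counted by plucking leaves: a leaf edge becomes an isolated edge, which can be put back in every
    corner except its own two and that of the plant. Plucking twice with N = 2(n+3) half-edges
    leaves, after division by N!, the factor (N-5)(N-4) = 2(n+1)(2n+1). The constants 4 and -3 come
    from algebra in a second variable marking n. With S the shift of U by one, W2 = S gives U^2 = S
    - B, and the generating function 3(U-1)B + (U-1)^3 of d differs from the disconnected part 2BU +
    US of W3 by -3S + 3U - 1; the remaining U(n+1) turns 3 into 4. Disjoint union along arbitrary
    bijections is the common device: it splits off components and isolated edges, and a union with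
    the empty map is a change of labels. *)

Lemma porbit_ind s (P : pred T) x :
  (forall z, P z -> P (s z)) -> P x -> forall y, y \in porbit s x -> P y.
Proof.
move=> Ps Px y /porbitP[i ->]; elim: i => [|i IHi]; first by rewrite expg0 perm1.
by rewrite expgSr permM; apply: Ps.
Qed.

Lemma mem_porbit_perm s x : s x \in porbit s x.
Proof. by have := mem_porbit s 1 x; rewrite expg1. Qed.

Lemma porbit_permr s x y : (s y \in porbit s x) = (y \in porbit s x).
Proof.
by rewrite -!eq_porbit_mem -(eqP (_ : porbit s (s y) == porbit s y)) // eq_porbit_mem mem_porbit_perm.
Qed.

Lemma porbit_eqP s x y : reflect (porbit s x = porbit s y) (x \in porbit s y).
Proof. by rewrite -eq_porbit_mem; apply: eqP. Qed.

Lemma card_porbits_split s x y : x != y -> y \in porbit s x ->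
  #|porbits (tperm x y * s)| = #|porbits s|.+1.
Proof.
move=> nxy syx; have := porbits_mul_tperm s x y.
by rewrite porbit_sym syx nxy /= addn0 addn1.
Qed.

Lemma card_porbits_merge s x y : y \notin porbit s x ->
  #|porbits s| = #|porbits (tperm x y * s)|.+1.
Proof.
move=> syx; have nxy : x != y by apply: contraNneq syx => ->; apply: porbit_id.
have := porbits_mul_tperm s x y.
by rewrite porbit_sym syx nxy /=; lia.
Qed.

(** Each of [s] and [tperm x y * s] arises from the other by the same transposition, so if both
    joined or both separated [x] and [y], the cycle count would move twice in the same direction. *)
Lemma porbit_tperm_split s x y : x != y ->
  (y \in porbit (tperm x y * s) x) = (y \notin porbit s x).
Proof.
move=> nxy; have [syx|nsyx] := boolP (y \in porbit s x).
  apply/negbTE/negP => s'yx; have := card_porbits_split nxy s'yx.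
  by rewrite mulgA tperm2 mul1g (card_porbits_split nxy syx); lia.
apply/negPn/negP => s'yx; have := card_porbits_merge s'yx.
by rewrite mulgA tperm2 mul1g (card_porbits_merge nsyx); lia.
Qed.

(** The transposition only redirects the arrows leaving [x] and [y]: a walk along an old cycle
    leaves its new cycle only at one of these points, and then lands on the new cycle of the
    other. *)
Lemma porbit_tperm_cover s x y z t : t \in porbit s z ->
  [|| t \in porbit (tperm x y * s) z, t \in porbit (tperm x y * s) x
    | t \in porbit (tperm x y * s) y].
Proof.
set s' := tperm x y * s.
move: t; apply: (@porbit_ind s (fun t => [|| t \in porbit s' z, t \in porbit s' x | t \in porbit s' y])).
- move=> w Pw; move: Pw; have [->|nwx] := eqVneq w x.
    have -> : s x = s' y by rewrite permM tpermR.
    by rewrite (mem_porbit_perm s' y) !orbT.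
  have [->|nwy] := eqVneq w y.
    have -> : s y = s' x by rewrite permM tpermL.
    by rewrite (mem_porbit_perm s' x) !orbT.
  have -> : s w = s' w by rewrite permM tpermD // eq_sym.
  by rewrite !porbit_permr.
- by rewrite porbit_id.
Qed.

(** Multiplicativity of the sign, read on cycle counts. With an even number of half-edges it makes E
    + k - V even. *)
Lemma odd_card_porbits_mul s a :
  odd #|porbits (s * a)| = (odd #|T| (+) odd #|porbits s|) (+) odd #|porbits a|.
Proof.
have := odd_permM s a; rewrite /odd_perm => /(congr1 (addb (odd #|T|))).
by rewrite !addbA addbb addFb => ->; rewrite addbAC -!addbA [RHS]addbC -!addbA.
Qed.

Definition joined s a := connect (fun x y => (y == s x) || (y == a x)).

Lemma joined_l s a x : joined s a x (s x).
Proof. by apply: connect1; rewrite eqxx. Qed.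

Lemma joined_r s a x : joined s a x (a x).
Proof. by apply: connect1; rewrite eqxx orbT. Qed.

Lemma joined_ind s a (P : pred T) x :
  (forall z, P z -> P (s z)) -> (forall z, P z -> P (a z)) ->
  P x -> forall y, joined s a x y -> P y.
Proof.
move=> Ps Pa Px y /connectP[p]; elim: p x Px => [|z p IHp] x Px /=; first by move=> _ ->.
move=> /andP[/orP[]/eqP zE pp yE]; apply: (IHp z) => //; rewrite zE.
  exact: Ps.
exact: Pa.
Qed.

Lemma joined_trans s a : transitive (joined s a).
Proof. by move=> y x z; apply: connect_trans. Qed.

Lemma joined_porbit_l s a x y : y \in porbit s x -> joined s a x y.
Proof.
move: y; apply: porbit_ind => [z xz|]; last exact: connect0.
exact: joined_trans xz (joined_l _ _ _).
Qed.

Lemma joined_porbit_r s a x y : y \in porbit a x -> joined s a x y.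
Proof.
move: y; apply: porbit_ind => [z xz|]; last exact: connect0.
exact: joined_trans xz (joined_r _ _ _).
Qed.

Lemma joined_porbit_mul s a x y : y \in porbit (s * a) x -> joined s a x y.
Proof.
move: y; apply: porbit_ind => [z xz|]; last exact: connect0.
by rewrite permM; apply: joined_trans xz (joined_trans (joined_l _ _ _) (joined_r _ _ _)).
Qed.

Lemma joined_sym s a x y : joined s a x y = joined s a y x.
Proof.
suff imp u v : joined s a u v -> joined s a v u by apply/idP/idP; apply: imp.
move: v; apply: joined_ind => [v vu|v vu|]; last exact: connect0.
  by apply: joined_trans vu; apply: joined_porbit_l; rewrite porbit_sym mem_porbit_perm.
by apply: joined_trans vu; apply: joined_porbit_r; rewrite porbit_sym mem_porbit_perm.
Qed.

(* Peel transpositions off [s]: each one splits a cycle of [s], and either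
   changes the cycle count of [s * a] by one, or separates two components. *)
Lemma euler_inequality s a (A : {set T}) :
  (forall x, exists2 y, y \in A & joined s a y x) ->
  (#|porbits s| + #|porbits a| + #|porbits (s * a)| <= #|T| + 2 * #|A|)%N.
Proof.
have [m] := ubnP #|[set x | s x != x]|; elim: m s A => // m IHm s A les domA.
have [/existsP[x nsx]|] := boolP [exists x, s x != x]; last first.
  rewrite negb_exists => /forallP s1.
  have -> : s = 1 by apply/permP => x; rewrite perm1; apply/eqP/negPn/s1.
  rewrite mul1g; have le1 : (#|porbits (1 : {perm T})| <= #|T|)%N by apply: leq_imset_card.
  suff lea : (#|porbits a| <= #|A|)%N by lia.
  rewrite (leq_trans _ (leq_imset_card (porbit a) A)) ?subset_leq_card //.
  apply/subsetP => _ /imsetP[x _ ->]; have [y Ay yx] := domA x.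
  apply/imsetP; exists y => //; apply/porbit_eqP; move: (x) yx; apply: joined_ind.
  - by move=> z; rewrite (eqP (negPn (s1 z))).
  - by move=> z; rewrite porbit_permr.
  - exact: porbit_id.
set y := s x in nsx.
have nxy : x != y by rewrite eq_sym.
pose s' := tperm x y * s.
have s'E : s = tperm x y * s' by rewrite mulgA tperm2 mul1g.
have s'y : s' y = y by rewrite permM tpermR.
have cs' : #|porbits s'| = #|porbits s|.+1.
  by apply: card_porbits_split => //; apply: mem_porbit_perm.
have les' : (#|[set z | s' z != z]| < m)%N.
  rewrite -ltnS; apply: leq_trans les; rewrite ltnS; apply: proper_card.
  apply/properP; split; last first.
    exists y; last by rewrite inE s'y eqxx.
    by rewrite inE; apply: contraNneq nsx => e; rewrite -(inj_eq (@perm_inj _ s)) e.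
  apply/subsetP => z; rewrite !inE permM; case: tpermP => [->|->|//].
    by move=> _; rewrite /y.
  by rewrite eqxx.
have s'a : s * a = tperm x y * (s' * a) by rewrite mulgA -s'E.
have tj z : joined s' a x y -> joined s' a z (tperm x y z).
  by case: tpermP => [->|->|_ _] //; rewrite 1?joined_sym // => _; apply: connect0.
have [jxy|njxy] := boolP (joined s' a x y).
  have domA' z : exists2 w, w \in A & joined s' a w z.
    have [w Aw wz] := domA z; exists w => //; move: (z) wz; apply: joined_ind => [u wu|u wu|].
    - rewrite s'E permM; apply: joined_trans wu _.
      by apply: joined_trans (tj _ jxy) (joined_l _ _ _).
    - by apply: joined_trans wu (joined_r _ _ _).
    - exact: connect0.
  have := IHm s' A les' domA'; have := porbits_mul_tperm (s' * a) x y.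
  by rewrite /= -s'a cs' nxy; case: (_ \notin _) => /=; lia.
(* The component of [x] and [y] falls into two pieces. The representative [w] of [x] reaches one of
   them, and [y] or [x] is added for the other. This raises [2 * #|A|] by two, which pays for the
   extra cycle in each of [s'] and [s' * a]. *)
have [z domA''] : exists z, forall u, exists2 w, w \in z |: A & joined s' a w u.
  have [w Aw wx] := domA x.
  pose reach v u := [|| joined s' a v u, joined s' a x u | joined s' a y u].
  have reachP v u : joined s a v u -> reach v u.
    move: u; apply: joined_ind.
    - move=> u; rewrite /reach s'E permM; case: tpermP => [->|->|_ _].
      + by rewrite (joined_l s' a y) !orbT.
      + by rewrite (joined_l s' a x) !orbT.
      + by case/or3P=> h; rewrite (joined_trans h (joined_l _ _ _)) ?orbT.
    - by move=> u; case/or3P=> h; rewrite /reach (joined_trans h (joined_r _ _ _)) ?orbT.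
    - by rewrite /reach /joined connect0.
  have wxy : joined s' a w x || joined s' a w y.
    apply/negPn/negP; rewrite negb_or => /andP[nwx nwy]; case/negP: (nwx).
    move: (x) wx; apply: joined_ind => [u wu|u wu|]; last exact: connect0.
      rewrite s'E permM tpermD ?(joined_trans wu (joined_l _ _ _)) //.
        by apply: contraNneq nwx => ->.
      by apply: contraNneq nwy => ->.
    by rewrite (joined_trans wu (joined_r _ _ _)).
  have dom z :
    (forall u, joined s' a x u || joined s' a y u -> joined s' a w u || joined s' a z u) ->
    forall u, exists2 w', w' \in z |: A & joined s' a w' u.
    move=> zP u; have [v Av /reachP/orP[vu|/zP/orP[wu|zu]]] := domA u.
    - by exists v; rewrite // !inE Av orbT.
    - by exists w; rewrite // !inE Aw orbT.
    - by exists z; rewrite // !inE eqxx.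
  case/orP: wxy => wz; [exists y|exists x]; apply: dom => u /orP[] h.
  - by rewrite (joined_trans wz h).
  - by rewrite h orbT.
  - by rewrite h orbT.
  - by rewrite (joined_trans wz h).
have leA : (#|z |: A| <= #|A|.+1)%N by rewrite cardsU1; case: (_ \notin _).
have := IHm s' _ les' domA''.
have nyx : y \notin porbit (s' * a) x.
  by apply: contra njxy; apply: joined_porbit_mul.
by have := card_porbits_merge nyx; rewrite -s'a cs'; lia.
Qed.

End Cycles.

(** * Planted maps and disjoint unions *)

(* Maps with half-edge set [T] and faces labelled by [K]: (alpha, gamma, plants),
   so that [MD N k] is [str 'I_k 'I_N].  Connectedness is not required. *)
Definition str (K T : finType) : Type := ({perm T} * {perm T} * {ffun K -> T})%type.

Section Structures.
Local Open Scope group_scope.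
Variables K T : finType.
Implicit Types (M : str K T) (x y : T) (k l : K).

Definition al M : {perm T} := M.1.1.
Definition ga M : {perm T} := M.1.2.
Definition pl M : {ffun K -> T} := M.2.
Definition si M : {perm T} := ga M * al M.

(** Distinctness of the faces of distinct plants is replaced by the plants meeting every face. For
    [#|K|] faces the two agree, and covering is the form carried through cutting and gluing. The
    condition on plants is sigma(p) = p with the involution moved across. *)
Definition planted M : bool :=
  [&& [forall x, al M (al M x) == x], [forall x, al M x != x],
      [forall k, ga M (pl M k) == al M (pl M k)],
      [forall x, exists k, x \in porbit (ga M) (pl M k)]
    & #|porbits (ga M)| == #|K|].

Lemma plantedP M : reflect
  [/\ involutive (al M), forall x, al M x != x,
      forall k, ga M (pl M k) = al M (pl M k),
      forall x, exists k, x \in porbit (ga M) (pl M k)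
    & #|porbits (ga M)| = #|K|] (planted M).
Proof.
apply: (iffP and5P) => -[h1 h2 h3 h4 h5]; split.
- by move=> x; apply/eqP/(forallP h1).
- exact/forallP.
- by move=> k; apply/eqP/(forallP h3).
- by move=> x; apply/existsP/(forallP h4).
- exact/eqP.
- by apply/forallP => x; rewrite h1.
- exact/forallP.
- by apply/forallP => k; rewrite h3.
- by apply/forallP => x; apply/existsP.
- exact/eqP.
Qed.

Lemma cover_face_inj M : (forall x, exists k, x \in porbit (ga M) (pl M k)) ->
  #|porbits (ga M)| = #|K| -> injective (fun k => porbit (ga M) (pl M k)).
Proof.
move=> cov cK; suff: {in [set: K] &, injective (fun k => porbit (ga M) (pl M k))}.
  by move=> inj k l; apply: inj; rewrite inE.
apply/imset_injP; rewrite cardsT -cK; apply/eqP/eq_card => A; apply/imsetP/imsetP.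
  by move=> [k _ ->]; exists (pl M k).
move=> [x _ ->]; have [k xk] := cov x; exists k; first by rewrite inE.
exact/porbit_eqP.
Qed.

Lemma planted_face_inj M : planted M -> injective (fun k => porbit (ga M) (pl M k)).
Proof. by case/plantedP => _ _ _; apply: cover_face_inj. Qed.

Lemma planted_same_face M k l : planted M ->
  (pl M k \in porbit (ga M) (pl M l)) = (k == l).
Proof.
move=> /planted_face_inj inj; rewrite -eq_porbit_mem.
exact: (inj_eq inj).
Qed.

Lemma face_inj_cover M : injective (fun k => porbit (ga M) (pl M k)) ->
  #|porbits (ga M)| = #|K| -> forall x, exists k, x \in porbit (ga M) (pl M k).
Proof.
move=> inj cK x.
have : [set porbit (ga M) (pl M k) | k in K] == porbits (ga M).
  rewrite eqEcard (card_imset _ inj) cK leqnn andbT.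
  by apply/subsetP => _ /imsetP[k _ ->]; apply: imset_f.
move=> /eqP eqs; have : porbit (ga M) x \in porbits (ga M) by apply: imset_f.
by rewrite -eqs => /imsetP[k _ /porbit_eqP xk]; exists k.
Qed.

Lemma al_face M k : planted M -> al M (pl M k) \in porbit (ga M) (pl M k).
Proof. by case/plantedP => _ _ /(_ k) <- _ _; apply: mem_porbit_perm. Qed.

Lemma si_plant M k : planted M -> si M (pl M k) = pl M k.
Proof. by case/plantedP => aK _ /(_ k) gp _ _; rewrite permM gp aK. Qed.

Lemma porbit_invol (a : {perm T}) x : a (a x) = x -> porbit a x = [set x; a x].
Proof.
move=> ax; apply/setP => y; apply/idP/idP; last first.
  by case/set2P => ->; rewrite ?porbit_id ?mem_porbit_perm.
move: y; apply: porbit_ind; last by rewrite set21.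
by move=> y /set2P[->|->]; rewrite ?ax ?set21 ?set22.
Qed.

Lemma porbits_partition (s : {perm T}) : partition (porbits s) [set: T].
Proof.
apply/and3P; split.
- rewrite eqEsubset subsetT; apply/subsetP => x _; apply/bigcupP.
  by exists (porbit s x); rewrite ?imset_f ?porbit_id.
- apply/trivIsetP => _ _ /imsetP[x _ ->] /imsetP[y _ ->]; apply: contraR.
  rewrite -setI_eq0 => /set0Pn[z /setIP[/porbit_eqP zx /porbit_eqP zy]].
  by rewrite -zx zy.
- by apply/imsetP => -[x _ /setP/(_ x)]; rewrite inE porbit_id.
Qed.

Lemma card_halfedges M : planted M -> #|T| = (2 * #|porbits (al M)|)%N.
Proof.
case/plantedP => aK nfix _ _ _.
have c2 : {in porbits (al M), forall A : {set T}, #|A| = 2}.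
  by move=> _ /imsetP[x _ ->]; rewrite porbit_invol ?aK // cards2 eq_sym nfix.
by have := card_uniform_partition c2 (porbits_partition _); rewrite cardsT mulnC.
Qed.

(** Two plants on a common edge would be equal or swapped by alpha, and [al_face] keeps the other
    end of a plant edge in the face of its plant. Hence there are exactly [#|K|] plant edges. *)
Lemma plant_edge_inj M : planted M -> injective (fun k => porbit (al M) (pl M k)).
Proof.
move=> pM k l; have [aK _ _ _ _] := plantedP _ pM.
move=> /porbit_eqP; rewrite porbit_invol // => /set2P pkl.
apply/eqP; rewrite -(planted_same_face k l pM).
by case: pkl => ->; rewrite ?porbit_id ?al_face.
Qed.

Lemma leq_faces_edges M : planted M -> (#|K| <= #|porbits (al M)|)%N.
Proof.
move=> pM; rewrite -(card_imset predT (plant_edge_inj pM)).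
by apply/subset_leq_card/subsetP => _ /imsetP[k _ ->]; apply: imset_f.
Qed.

(* For a map with [c] components this is the sum of the genera plus [k - c]. *)
Definition eta M : nat :=
  ((#|porbits (al M)| + #|porbits (ga M)|) - #|porbits (si M)|)./2.

Definition con M := joined (ga M) (al M).

Lemma odd_si M : planted M ->
  odd #|porbits (si M)| = odd (#|porbits (al M)| + #|porbits (ga M)|).
Proof.
by move=> pM; rewrite odd_card_porbits_mul (card_halfedges pM) mul2n odd_double addFb oddD addbC.
Qed.

(** Undoes the truncated subtraction and the halving in [eta]: with the plants as representatives
    the genus inequality reads V <= E + k, because [#|T|] is 2E, and the sign gives the parity. *)
Lemma etaE M : planted M ->
  (#|porbits (si M)| + 2 * eta M = #|porbits (al M)| + #|porbits (ga M)|)%N.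
Proof.
move=> pM; have [_ _ _ cov cK] := plantedP _ pM.
have leA : (#|[set pl M k | k in K]| <= #|K|)%N by apply: leq_imset_card.
have dom x : exists2 y, y \in [set pl M k | k in K] & joined (ga M) (al M) y x.
  have [k xk] := cov x; exists (pl M k); first exact: imset_f.
  exact: joined_porbit_l.
have := euler_inequality dom.
have := odd_si pM; have := card_halfedges pM.
rewrite /eta -/(si M) cK => cT oddE le.
have le2 : (#|porbits (si M)| <= #|porbits (al M)| + #|K|)%N by lia.
have : ~~ odd ((#|porbits (al M)| + #|K|) - #|porbits (si M)|).
  by rewrite oddB // oddE addbb.
by move=> /even_halfK; rewrite -muln2; lia.
Qed.

Definition connected M := [forall x, forall y, con M x y].

Lemma connectedP M k : (connected M) = [forall x, con M (pl M k) x].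
Proof.
apply/idP/idP => [/forallP/(_ (pl M k)) //|/forallP h].
apply/forallP => x; apply/forallP => y.
by apply: joined_trans (h y); rewrite joined_sym; apply: h.
Qed.

(** Non-negativity of the genus: in a connected map a single plant suffices as representative in the
    genus inequality. *)
Lemma eta_connected M : planted M -> connected M -> (0 < #|K|)%N -> (#|K| <= (eta M).+1)%N.
Proof.
move=> pM cM /card_gt0P[k _]; have [_ _ _ cov cK] := plantedP _ pM.
have dom x : exists2 y, y \in [set pl M k] & joined (ga M) (al M) y x.
  exists (pl M k); first exact: set11.
  by have/forallP/(_ x) := forallP cM (pl M k).
have := euler_inequality dom.
have := etaE pM; have := card_halfedges pM.
by rewrite cK cards1 -/(si M); lia.
Qed.

End Structures.

(** * Disjoint unions along chosen bijections of labels and half-edges *)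

Section Glue.
Local Open Scope group_scope.
Variables (K1 K2 K T1 T2 T : finType).
Variables (f : K1 + K2 -> K) (fd : K -> K1 + K2) (g : T1 + T2 -> T) (gd : T -> T1 + T2).
Hypotheses (fK : cancel f fd) (fdK : cancel fd f) (gK : cancel g gd) (gdK : cancel gd g).

Definition sumfun (A1 A2 B1 B2 : Type) (h1 : A1 -> B1) (h2 : A2 -> B2) (z : A1 + A2) : B1 + B2 :=
  match z with inl y => inl (h1 y) | inr y => inr (h2 y) end.

Lemma glue_inj (s1 : {perm T1}) (s2 : {perm T2}) :
  injective (fun x => g (sumfun s1 s2 (gd x))).
Proof.
move=> x y /(can_inj gK); rewrite -{2}(gdK x) -{2}(gdK y).
by case: (gd x) => a; case: (gd y) => b //= -[/perm_inj ->].
Qed.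

(** Keeping the bijection of [T1 + T2] with [T] as a parameter lets one construction serve for a
    component and its complement, for an isolated edge and the rest, and for relabelling, where one
    summand is [void]. *)
Definition glue s1 s2 : {perm T} := perm (@glue_inj s1 s2).

Lemma glue_l s1 s2 x : glue s1 s2 (g (inl x)) = g (inl (s1 x)).
Proof. by rewrite permE gK. Qed.

Lemma glue_r s1 s2 x : glue s1 s2 (g (inr x)) = g (inr (s2 x)).
Proof. by rewrite permE gK. Qed.

Lemma glue_point_ind (P : T -> Prop) : (forall x, P (g (inl x))) -> (forall x, P (g (inr x))) -> forall x, P x.
Proof. by move=> Pl Pr x; rewrite -(gdK x); case: (gd x). Qed.

Lemma glue_face_ind (P : K -> Prop) : (forall x, P (f (inl x))) -> (forall x, P (f (inr x))) -> forall x, P x.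
Proof. by move=> Pl Pr x; rewrite -(fdK x); case: (fd x). Qed.

Lemma glueM s1 s2 t1 t2 : glue s1 s2 * glue t1 t2 = glue (s1 * t1) (s2 * t2).
Proof. by apply/permP; apply: glue_point_ind => x; rewrite permM ?glue_l ?glue_r permM. Qed.

Lemma glue1 : glue 1 1 = 1.
Proof. by apply/permP; apply: glue_point_ind => x; rewrite ?glue_l ?glue_r !perm1. Qed.

Lemma glueX s1 s2 n : glue s1 s2 ^+ n = glue (s1 ^+ n) (s2 ^+ n).
Proof. by elim: n => [|n IHn]; rewrite ?expg0 ?glue1 // !expgS IHn glueM. Qed.

Lemma g_eq x y : (g x == g y) = (x == y).
Proof. exact: (inj_eq (can_inj gK)). Qed.

Lemma porbit_glue_l s1 s2 x : porbit (glue s1 s2) (g (inl x)) = [set g (inl y) | y in porbit s1 x].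
Proof.
apply/setP => y; apply/porbitP/imsetP => [[i ->]|[z /porbitP[i ->] ->]].
  by exists ((s1 ^+ i) x); rewrite ?mem_porbit // glueX glue_l.
by exists i; rewrite glueX glue_l.
Qed.

Lemma porbit_glue_r s1 s2 x : porbit (glue s1 s2) (g (inr x)) = [set g (inr y) | y in porbit s2 x].
Proof.
apply/setP => y; apply/porbitP/imsetP => [[i ->]|[z /porbitP[i ->] ->]].
  by exists ((s2 ^+ i) x); rewrite ?mem_porbit // glueX glue_r.
by exists i; rewrite glueX glue_r.
Qed.

Lemma gl_inj : injective (fun x => g (inl x)).
Proof. by move=> x y /(can_inj gK)[]. Qed.

Lemma gr_inj : injective (fun x => g (inr x)).
Proof. by move=> x y /(can_inj gK)[]. Qed.

Lemma mem_porbit_glue_ll s1 s2 x y :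
  (g (inl y) \in porbit (glue s1 s2) (g (inl x))) = (y \in porbit s1 x).
Proof. by rewrite porbit_glue_l (mem_imset _ _ gl_inj). Qed.

Lemma mem_porbit_glue_rr s1 s2 x y :
  (g (inr y) \in porbit (glue s1 s2) (g (inr x))) = (y \in porbit s2 x).
Proof. by rewrite porbit_glue_r (mem_imset _ _ gr_inj). Qed.

Lemma mem_porbit_glue_lr s1 s2 x y : (g (inl y) \in porbit (glue s1 s2) (g (inr x))) = false.
Proof. by rewrite porbit_glue_r; apply/imsetP => -[z _ /(can_inj gK)]. Qed.

Lemma mem_porbit_glue_rl s1 s2 x y : (g (inr y) \in porbit (glue s1 s2) (g (inl x))) = false.
Proof. by rewrite porbit_sym mem_porbit_glue_lr. Qed.

Lemma card_porbits_glue s1 s2 : #|porbits (glue s1 s2)| = (#|porbits s1| + #|porbits s2|)%N.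
Proof.
pose Fl (A : {set T1}) := [set g (inl y) | y in A].
pose Fr (A : {set T2}) := [set g (inr y) | y in A].
have -> : porbits (glue s1 s2) = Fl @: porbits s1 :|: Fr @: porbits s2.
  apply/setP => A; apply/imsetP/setUP => [[x _ ->]|[|] /imsetP[_ /imsetP[x _ ->] ->]].
  - move: x; apply: glue_point_ind => x; [left|right]; rewrite ?porbit_glue_l ?porbit_glue_r.
      by apply: (imset_f Fl); apply: imset_f.
    by apply: (imset_f Fr); apply: imset_f.
  - by exists (g (inl x)); rewrite // porbit_glue_l.
  - by exists (g (inr x)); rewrite // porbit_glue_r.
rewrite cardsU (_ : _ :&: _ = set0) ?cards0 ?subn0; last first.
  apply/setP => A; rewrite in_set0; apply/setIP => -[/imsetP[_ /imsetP[x _ ->] ->]].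
  move=> /imsetP[_ /imsetP[y _ ->]] /setP/(_ (g (inl x))).
  rewrite (mem_imset _ _ gl_inj) porbit_id => /esym/imsetP[z _].
  by move/(can_inj gK).
have iFl : injective Fl := imset_inj gl_inj.
have iFr : injective Fr := imset_inj gr_inj.
by rewrite (card_imset _ iFl) (card_imset _ iFr).
Qed.

Definition glueS (M1 : str K1 T1) (M2 : str K2 T2) : str K T :=
  (glue (al M1) (al M2), glue (ga M1) (ga M2),
   [ffun k => g (sumfun (pl M1) (pl M2) (fd k))]).

Lemma pl_glue_l M1 M2 k : pl (glueS M1 M2) (f (inl k)) = g (inl (pl M1 k)).
Proof. by rewrite ffunE fK. Qed.

Lemma pl_glue_r M1 M2 k : pl (glueS M1 M2) (f (inr k)) = g (inr (pl M2 k)).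
Proof. by rewrite ffunE fK. Qed.

Lemma si_glue M1 M2 : si (glueS M1 M2) = glue (si M1) (si M2).
Proof. exact: glueM. Qed.

Lemma card_glue_faces : #|K| = (#|K1| + #|K2|)%N.
Proof. by rewrite -card_sum; apply: bij_eq_card; exists f. Qed.

Lemma planted_glue M1 M2 : planted (glueS M1 M2) = planted M1 && planted M2.
Proof.
apply/plantedP/andP; last first.
  case=> /plantedP[i1 n1 p1 c1 k1] /plantedP[i2 n2 p2 c2 k2]; split.
  - by apply: glue_point_ind => x; rewrite ?glue_l ?glue_r ?i1 ?i2.
  - by apply: glue_point_ind => x; rewrite ?glue_l ?glue_r g_eq ?(inj_eq (@inl_inj _ _)) ?(inj_eq (@inr_inj _ _)).
  - by apply: glue_face_ind => k; rewrite ?pl_glue_l ?pl_glue_r ?glue_l ?glue_r ?p1 ?p2.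
  - apply: glue_point_ind => x; [have [k xk] := c1 x; exists (f (inl k))|have [k xk] := c2 x; exists (f (inr k))].
      by rewrite pl_glue_l mem_porbit_glue_ll.
    by rewrite pl_glue_r mem_porbit_glue_rr.
  - by rewrite card_porbits_glue k1 k2 card_glue_faces.
move=> [i n p c ck].
have c1 x : exists k, x \in porbit (ga M1) (pl M1 k).
  have [k] := c (g (inl x)); move: k; apply: glue_face_ind => k.
    by rewrite pl_glue_l mem_porbit_glue_ll; exists k.
  by rewrite pl_glue_r mem_porbit_glue_lr.
have c2 x : exists k, x \in porbit (ga M2) (pl M2 k).
  have [k] := c (g (inr x)); move: k; apply: glue_face_ind => k.
    by rewrite pl_glue_l mem_porbit_glue_rl.
  by rewrite pl_glue_r mem_porbit_glue_rr; exists k.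
(* Only the sum of the two face counts is known. As the plants meet every face, each count is at
   most the number of its labels, so both bounds are equalities. *)
have le1 : (#|porbits (ga M1)| <= #|K1|)%N.
  apply: leq_trans (leq_imset_card (fun k => porbit (ga M1) (pl M1 k)) predT).
  apply/subset_leq_card/subsetP => _ /imsetP[x _ ->]; have [k xk] := c1 x.
  by apply/imsetP; exists k => //; apply/porbit_eqP.
have le2 : (#|porbits (ga M2)| <= #|K2|)%N.
  apply: leq_trans (leq_imset_card (fun k => porbit (ga M2) (pl M2 k)) predT).
  apply/subset_leq_card/subsetP => _ /imsetP[x _ ->]; have [k xk] := c2 x.
  by apply/imsetP; exists k => //; apply/porbit_eqP.
move: ck; rewrite card_porbits_glue card_glue_faces => ck.
split; apply/plantedP; split => //; try lia.
- by move=> x; apply: gl_inj; have := i (g (inl x)); rewrite !glue_l.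
- by move=> x; have := n (g (inl x)); rewrite !glue_l g_eq.
- by move=> k; apply: gl_inj; have := p (f (inl k)); rewrite pl_glue_l !glue_l.
- by move=> x; apply: gr_inj; have := i (g (inr x)); rewrite !glue_r.
- by move=> x; have := n (g (inr x)); rewrite !glue_r g_eq.
- by move=> k; apply: gr_inj; have := p (f (inr k)); rewrite pl_glue_r !glue_r.
Qed.

Lemma eta_glue M1 M2 : planted M1 -> planted M2 -> eta (glueS M1 M2) = (eta M1 + eta M2)%N.
Proof.
move=> p1 p2; have := etaE p1; have := etaE p2; have := @etaE _ _ (glueS M1 M2).
rewrite planted_glue p1 p2 si_glue !card_porbits_glue => /(_ isT); lia.
Qed.

Lemma con_glue_l M1 M2 x y : con (glueS M1 M2) (g (inl x)) (g y) =
  if y is inl y' then con M1 x y' else false.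
Proof.
apply/idP/idP.
  suff h z : con (glueS M1 M2) (g (inl x)) z -> if gd z is inl z' then con M1 x z' else false.
    by move/h; rewrite gK.
  move: z; apply: joined_ind; last by rewrite gK /con /joined connect0.
    apply: glue_point_ind => z; rewrite ?glue_l ?glue_r !gK // => xz.
    exact: joined_trans xz (joined_l _ _ _).
  apply: glue_point_ind => z; rewrite ?glue_l ?glue_r !gK // => xz.
  exact: joined_trans xz (joined_r _ _ _).
case: y => // y; move: y; apply: joined_ind; last by rewrite /con /joined connect0.
  by move=> z xz; apply: joined_trans xz _; rewrite -[g (inl (_ z))](glue_l _ (ga M2)); apply: joined_l.
by move=> z xz; apply: joined_trans xz _; rewrite -[g (inl (_ z))](glue_l _ (al M2)); apply: joined_r.
Qed.

Definition isl (A B : Type) (z : A + B) := if z is inl _ then true else false.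

Definition sep (M : str K T) :=
  [&& [forall x, isl (gd (al M x)) == isl (gd x)], [forall x, isl (gd (ga M x)) == isl (gd x)]
    & [forall k, isl (gd (pl M k)) == isl (fd k)]].

Lemma glue_surj (s : {perm T}) : (forall x, isl (gd (s x)) = isl (gd x)) ->
  exists s1 s2, s = glue s1 s2.
Proof.
move=> ss.
have /fin_all_exists[h1 h1E] : forall x : T1, exists y, s (g (inl x)) = g (inl y).
  move=> x; have := ss (g (inl x)); rewrite gK; case e: (gd _) => [y|//] _.
  by exists y; rewrite -e gdK.
have /fin_all_exists[h2 h2E] : forall x : T2, exists y, s (g (inr x)) = g (inr y).
  move=> x; have := ss (g (inr x)); rewrite gK; case e: (gd _) => [//|y] _.
  by exists y; rewrite -e gdK.
have i1 : injective h1 by move=> x y e; apply/gl_inj/(@perm_inj _ s); rewrite !h1E e.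
have i2 : injective h2 by move=> x y e; apply/gr_inj/(@perm_inj _ s); rewrite !h2E e.
exists (perm i1), (perm i2); apply/permP; apply: glue_point_ind => x.
  by rewrite glue_l permE.
by rewrite glue_r permE.
Qed.

Lemma glue_injective s1 s2 t1 t2 : glue s1 s2 = glue t1 t2 -> s1 = t1 /\ s2 = t2.
Proof.
move=> /permP e; split; apply/permP => x.
  by apply: gl_inj; have := e (g (inl x)); rewrite !glue_l.
by apply: gr_inj; have := e (g (inr x)); rewrite !glue_r.
Qed.

(** [glueS] is injective, and its image among the planted maps is cut out by [sep]. The component
    decomposition, the removal of an isolated edge and the change of label types are all
    instances. *)
Lemma sum_glue (V : nmodType) (G : str K T -> V) :
  (\sum_(M | planted M && sep M) G M =
   \sum_(M1 | planted M1) \sum_(M2 | planted M2) G (glueS M1 M2))%R.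
Proof.
rewrite pair_big /=.
rewrite -(big_imset (h := fun P => glueS P.1 P.2) (A := [pred P | planted P.1 && planted P.2]) G).
  apply: eq_bigl => M; apply/andP/imsetP => [[pM /and3P[/forallP sa /forallP sg /forallP sp]]|].
    have [a1 [a2 aE]] := glue_surj (fun x => eqP (sa x)).
    have [g1 [g2 gE]] := glue_surj (fun x => eqP (sg x)).
    have /fin_all_exists[p1 p1E] : forall k : K1, exists y, pl M (f (inl k)) = g (inl y).
      move=> k; have := sp (f (inl k)); rewrite fK; case e: (gd _) => [y|//] _.
      by exists y; rewrite -e gdK.
    have /fin_all_exists[p2 p2E] : forall k : K2, exists y, pl M (f (inr k)) = g (inr y).
      move=> k; have := sp (f (inr k)); rewrite fK; case e: (gd _) => [//|y] _.
      by exists y; rewrite -e gdK.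
    have ME : M = glueS (a1, g1, finfun p1) (a2, g2, finfun p2).
      rewrite /glueS -aE -gE [LHS]surjective_pairing [M.1]surjective_pairing; congr (_, _, _).
      by apply/ffunP; apply: glue_face_ind => k; rewrite ffunE fK /= ffunE ?p1E ?p2E.
    exists ((a1, g1, finfun p1), (a2, g2, finfun p2)) => //.
    by rewrite inE -planted_glue -ME.
  move=> [[M1 M2]]; rewrite inE => pM ->; rewrite planted_glue /=; split=> //.
  apply/and3P; split; apply/forallP.
  - by apply: glue_point_ind => x; rewrite ?glue_l ?glue_r !gK.
  - by apply: glue_point_ind => x; rewrite ?glue_l ?glue_r !gK.
  - by apply: glue_face_ind => k; rewrite ?pl_glue_l ?pl_glue_r !gK fK.
move=> [[[a1 g1] p1] [[a2 g2] p2]] [[[b1 h1] q1] [[b2 h2] q2]] _ _ [].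
rewrite /al /ga /pl /= => /glue_injective[-> ->] /glue_injective[-> ->] e.
have -> : p1 = q1.
  apply/ffunP => k; apply: gl_inj; move/ffunP/(_ (f (inl k))): e.
  by rewrite !ffunE fK.
have -> // : p2 = q2.
apply/ffunP => k; apply: gr_inj; move/ffunP/(_ (f (inr k))): e.
by rewrite !ffunE fK.
Qed.

End Glue.

(** * Generating functions and decomposition into components *)

Definition gfun (K T : finType) : {poly rat} := \sum_(M : str K T | planted M) 'X^(eta M).

Definition cgfun (K T : finType) : {poly rat} :=
  \sum_(M : str K T | planted M && connected M) 'X^(eta M).

Lemma card_eq_can (A B : finType) : #|A| = #|B| ->
  exists (h : A -> B) (h' : B -> A), cancel h h' /\ cancel h' h.
Proof.
move=> e; exists (fun x => enum_val (cast_ord e (enum_rank x))).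
exists (fun x => enum_val (cast_ord (esym e) (enum_rank x))).
by split=> x; rewrite enum_valK ?cast_ordK ?cast_ordKV enum_rankK.
Qed.

Lemma card_eq_can_void (A B : finType) : #|A| = #|B| ->
  exists (h : A + void -> B) (h' : B -> A + void), cancel h h' /\ cancel h' h.
Proof. by move=> e; apply: card_eq_can; rewrite card_sum card_void addn0. Qed.

Lemma planted_void (K T : finType) (M : str K T) : #|T| = 0%N -> #|K| = 0%N -> planted M.
Proof.
move=> T0 K0; have nT (x : T) : False by have := fintype0 x T0.
have nK (x : K) : False by have := fintype0 x K0.
apply/plantedP; split; try by [move=> x; case: (nT x) | move=> x; case: (nK x)].
rewrite K0; apply/eqP; rewrite -leqn0 -T0; exact: leq_imset_card.
Qed.

Lemma str_void_eq (M M' : str void void) : M = M'.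
Proof.
case: M M' => [[a c] p] [[a' c'] p'].
by congr (_, _, _); [apply/permP|apply/permP|apply/ffunP]; case.
Qed.

Lemma sum_str_void (V : nmodType) (F : str void void -> V) (M : str void void) :
  \sum_(M' | planted M') F M' = F M.
Proof.
rewrite (big_pred1 M) // => M'; rewrite planted_void ?card_void //.
by rewrite (str_void_eq M' M) /= eqxx.
Qed.

Lemma eta_void (K T : finType) (M : str K T) : #|T| = 0%N -> eta M = 0%N.
Proof.
move=> T0; have c0 (s : {perm T}) : #|porbits s| = 0%N.
  by apply/eqP; rewrite -leqn0 -T0; apply: leq_imset_card.
by rewrite /eta !c0.
Qed.

Lemma isl_void (A : Type) (z : A + void) : isl z.
Proof. by case: z => // -[]. Qed.

Lemma connected_glue_void (K T K' T' : finType) (fd : K' -> K + void)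
    (g : T + void -> T') (gd : T' -> T + void) (gK : cancel g gd) (gdK : cancel gd g)
    (M : str K T) (M0 : str void void) :
  connected (glueS fd gK gdK M M0) = connected M.
Proof.
apply/forallP/forallP => h x.
  apply/forallP => y; move/forallP: (h (g (inl x))) => /(_ (g (inl y))).
  by rewrite (con_glue_l fd gK gdK).
move: x; apply: (glue_point_ind gdK) => // x; apply/forallP; apply: (glue_point_ind gdK) => // y.
by rewrite (con_glue_l fd gK gdK); move/forallP: (h x).
Qed.

Section Transport.
Variables K T K' T' : finType.
Hypotheses (eK : #|K| = #|K'|) (eT : #|T| = #|T'|).

(** Relabelling is treated as disjoint union with the empty map, so the invariance of [planted] and
    [eta] is inherited from the gluing lemmas. *)
Lemma gfun_card : gfun K T = gfun K' T'.
Proof.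
have [f [fd [fK fdK]]] := card_eq_can_void eK.
have [g [gd [gK gdK]]] := card_eq_can_void eT.
pose M0 : str void void := (1%g, 1%g, [ffun k : void => k]).
rewrite /gfun [RHS](eq_bigl (fun M => planted M && sep fd gd M)); last first.
  move=> M; rewrite (_ : sep fd gd M) ?andbT //.
  by apply/and3P; split; apply/forallP => x; rewrite !isl_void.
rewrite (sum_glue fK fdK gK gdK); apply: eq_bigr => M pM.
rewrite (sum_str_void _ M0) (eta_glue fK fdK gK gdK pM) ?planted_void ?card_void //.
by rewrite (eta_void M0) ?card_void ?addn0.
Qed.

Lemma cgfun_card : cgfun K T = cgfun K' T'.
Proof.
have [f [fd [fK fdK]]] := card_eq_can_void eK.
have [g [gd [gK gdK]]] := card_eq_can_void eT.
pose M0 : str void void := (1%g, 1%g, [ffun k : void => k]).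
rewrite /cgfun [RHS]big_mkcondr [LHS]big_mkcondr /=.
rewrite [RHS](eq_bigl (fun M => planted M && sep fd gd M)); last first.
  move=> M; rewrite (_ : sep fd gd M) ?andbT //.
  by apply/and3P; split; apply/forallP => x; rewrite !isl_void.
rewrite (sum_glue fK fdK gK gdK); apply: eq_bigr => M pM.
rewrite (sum_str_void _ M0) (eta_glue fK fdK gK gdK pM) ?planted_void ?card_void //.
by rewrite (eta_void M0) ?card_void ?addn0 // connected_glue_void.
Qed.

End Transport.

(** * The component of a chosen face *)

Section Component.
Variables K T : finType.
Implicit Type M : str K T.

Definition unsplit_pred (A : finType) (P : pred A) (z : {x | P x} + {x | ~~ P x}) : A :=
  match z with inl u => sval u | inr u => sval u end.

Definition split_pred (A : finType) (P : pred A) (x : A) : {x | P x} + {x | ~~ P x} :=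
  match boolP (P x) with
  | AltTrue h => inl (exist _ x h) | AltFalse h => inr (exist (fun x => ~~ P x) x h)
  end.

Lemma unsplit_predK (A : finType) (P : pred A) : cancel (@unsplit_pred A P) (@split_pred A P).
Proof.
case=> -[x px]; rewrite /split_pred /=; case: {-}_ / boolP => h; try by congr (_ _); apply: val_inj.
  by have := px; rewrite (negbTE h).
by have := px; rewrite h.
Qed.

Lemma split_predK (A : finType) (P : pred A) : cancel (@split_pred A P) (@unsplit_pred A P).
Proof. by move=> x; rewrite /split_pred; case: {-}_ / boolP. Qed.

Lemma isl_split_pred (A : finType) (P : pred A) x : isl (@split_pred A P x) = P x.
Proof. by rewrite /split_pred; case: {-}_ / boolP => h; rewrite ?h ?(negbTE h). Qed.

Definition comp M k : {set T} := [set x | con M (pl M k) x].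

Lemma comp_closed M k x y : con M x y -> (y \in comp M k) = (x \in comp M k).
Proof.
move=> xy; rewrite !inE; apply/idP/idP => h; last exact: joined_trans h xy.
by apply: joined_trans h _; rewrite joined_sym.
Qed.

Definition comp_faces M k : {set K} := [set l | pl M l \in comp M k].

(** A component is closed under both permutations, so the map is the disjoint union of a connected
    map on [S] with faces [K1] and an arbitrary planted map on the complements. *)
Lemma gfun_component (k0 : K) (S : {set T}) (K1 : {set K}) : k0 \in K1 ->
  \sum_(M | planted M && ((comp M k0, comp_faces M k0) == (S, K1))) 'X^(eta M) =
  cgfun {k | k \in K1} {x | x \in S} * gfun {k | k \notin K1} {x | x \notin S} :> {poly rat}.
Proof.
move=> k0K1.
pose fK := @unsplit_predK K (mem K1); pose fdK := @split_predK K (mem K1).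
pose gK := @unsplit_predK T (mem S); pose gdK := @split_predK T (mem S).
rewrite big_mkcondr /=.
(* The condition on the component already implies [sep], which is inserted to reach the form of
   [sum_glue]. *)
rewrite (eq_bigr (fun M => if sep (@split_pred K (mem K1)) (@split_pred T (mem S)) M then
    if (comp M k0, comp_faces M k0) == (S, K1) then 'X^(eta M) else 0 else 0)).
  rewrite -big_mkcondr (sum_glue fK fdK gK gdK) /cgfun /gfun [X in _ = X * _]big_mkcondr big_distrl /=.
  apply: eq_bigr => M1 p1; rewrite big_distrr /=; apply: eq_bigr => M2 p2.
  rewrite (eta_glue fK fdK gK gdK) // (fun_if (fun z => z * 'X^(eta M2))) mul0r -exprD.
  congr (if _ then _ else _).
  pose u0 : {k | k \in K1} := exist _ k0 k0K1.
  rewrite (connectedP M1 u0).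
  have k0E : k0 = @unsplit_pred K (mem K1) (inl u0) by [].
  set M := glueS _ _ _ _ _; have plE : pl M k0 = @unsplit_pred T (mem S) (inl (pl M1 u0)).
    by rewrite {1}k0E (pl_glue_l fK gK).
  apply/idP/idP.
    move=> /eqP[/setP cS _]; apply/forallP => x; have xS : sval x \in S by case: x.
    have := cS (sval x); rewrite xS inE plE -[sval x]/(@unsplit_pred T (mem S) (inl x)).
    by rewrite (con_glue_l _ gK gdK).
  move=> /forallP cM.
  have cS : comp M k0 = S.
    apply/setP; apply: (glue_point_ind gdK) => -[x xS]; rewrite inE plE (con_glue_l _ gK gdK) /=.
      by rewrite cM; apply: esym.
    exact/esym/negbTE.
  rewrite xpair_eqE cS eqxx /=; apply/eqP/setP; apply: (glue_face_ind fdK) => -[k kK]; rewrite inE cS.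
    by rewrite (pl_glue_l fK gK) (_ : _ \in K1) //; case: (pl M1 _).
  rewrite (pl_glue_r fK gK) (_ : (_ \in K1) = false); last exact/negbTE.
  by apply/negbTE; case: (pl M2 _).
move=> M pM; case: ifP => [/eqP e|_]; last by case: ifP.
have [/= cS fS] := (congr1 fst e, congr1 snd e); rewrite (_ : sep _ _ _) //.
apply/and3P; split; apply/forallP => x; rewrite !isl_split_pred /= -cS.
- by rewrite (comp_closed _ (joined_r _ _ _)).
- by rewrite (comp_closed _ (joined_l _ _ _)).
- by apply/eqP; rewrite -[RHS]/(x \in K1) -fS [RHS]inE.
Qed.

Lemma gfun_decompose (k0 : K) :
  gfun K T = \sum_(S : {set T}) \sum_(K1 : {set K} | k0 \in K1)
    cgfun 'I_#|K1| 'I_#|S| * gfun 'I_(#|K| - #|K1|) 'I_(#|T| - #|S|).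
Proof.
rewrite pair_big /= /gfun (partition_big (fun M => (comp M k0, comp_faces M k0))
  (fun P => k0 \in P.2)); last first.
  by move=> M _; rewrite !inE /con /joined connect0.
apply: eq_bigr => -[S K1] /= k0K1; rewrite gfun_component //.
congr (_ * _); [apply: cgfun_card|apply: gfun_card]; rewrite card_sig card_ord //.
  by rewrite -(cardC K1) addKn.
by rewrite -(cardC S) addKn.
Qed.

End Component.

Lemma sum_set_card (V : nmodType) (A : finType) (h : nat -> V) :
  \sum_(S : {set A}) h #|S| = \sum_(a < #|A|.+1) h a *+ 'C(#|A|, a).
Proof.
rewrite (partition_big (fun S : {set A} => inord #|S| : 'I_#|A|.+1) predT) //=.
apply: eq_bigr => a _; rewrite -card_draws -sumr_const.
have e (S : {set A}) : (inord #|S| == a :> 'I__) = (#|S| == a).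
  by rewrite -val_eqE /= inordK // ltnS max_card.
rewrite (eq_bigl (fun S : {set A} => #|S| == a)) //.
rewrite [RHS](eq_bigl (fun S : {set A} => #|S| == a)); last by move=> S; rewrite inE.
by apply: eq_bigr => S /eqP ->.
Qed.

Lemma sum_pointed_set_card (V : nmodType) (A : finType) (x : A) (h : nat -> V) :
  \sum_(S : {set A} | x \in S) h #|S| = \sum_(a < #|A|) h a.+1 *+ 'C(#|A|.-1, a).
Proof.
have cA : #|A| = #|A|.-1.+1 by rewrite prednK //; apply/card_gt0P; exists x.
have cD : #|{: {y : A | y != x}}| = #|A|.-1 by rewrite card_sig cardC1.
pose D := {y : A | y != x}.
rewrite (reindex_onto (fun S : {set D} => x |: [set val y | y in S])
  (fun S : {set A} => [set y : D | val y \in S])); last first.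
  move=> S xS; apply/setP => y; rewrite !inE; have [-> //|nyx] := eqVneq y x.
  rewrite /=; apply/imsetP/idP => [[z]|yS]; first by rewrite inE => zS ->.
  by exists (exist _ y nyx) => //; rewrite inE.
rewrite (eq_bigl predT) => [|S]; last first.
  rewrite setU11 /=; apply/eqP/setP => y; rewrite !inE (negbTE (valP y)) /=.
  by rewrite (mem_imset _ _ val_inj).
rewrite (eq_bigr (fun S : {set D} => h #|S|.+1)) => [|S _]; last first.
  rewrite cardsU1 card_imset; last exact: val_inj.
  rewrite (_ : x \notin _) //; apply/imsetP => -[y _ xy].
  by have := valP y; rewrite -xy eqxx.
by rewrite (sum_set_card _ (fun m => h m.+1)) cD -cA.
Qed.

Definition ngfun (k N : nat) : {poly rat} := N`!%:R^-1 *: gfun 'I_k 'I_N.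

Definition ncgfun (k N : nat) : {poly rat} := N`!%:R^-1 *: cgfun 'I_k 'I_N.

Lemma factr_neq0 n : n`!%:R != 0 :> rat.
Proof. by rewrite pnatr_eq0 -lt0n fact_gt0. Qed.

(** The choice of the half-edges of the component of face 0 is a binomial absorbed by the
    factorials. Faces stay labelled, so the choice of its [j] companion faces survives as
    ['C(k, j)]. *)
Lemma ngfun_decompose k N : ngfun k.+1 N =
  \sum_(a < N.+1) \sum_(j < k.+1) (ncgfun j.+1 a * ngfun (k - j) (N - a)) *+ 'C(k, j).
Proof.
rewrite /ngfun (gfun_decompose _ ord0) !card_ord.
rewrite (sum_set_card _ (fun m => \sum_(K1 : {set 'I_k.+1} | ord0 \in K1)
   cgfun 'I_#|K1| 'I_m * gfun 'I_(k.+1 - #|K1|) 'I_(N - m))) card_ord.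
rewrite scaler_sumr; apply: eq_bigr => a _.
rewrite (sum_pointed_set_card _ (fun m => cgfun 'I_m 'I_a * gfun 'I_(k.+1 - m) 'I_(N - a))).
rewrite card_ord /= -sumrMnl scaler_sumr; apply: eq_bigr => j _.
rewrite subSS -mulrnA mulnC mulrnA -scalerMnr; congr (_ *+ _).
rewrite /ncgfun -scalerAl -scalerAr scalerA -mulr_natr -scaler_nat scalerA.
congr (_ *: _); have := bin_fact (ltnSE (ltn_ord a)) => /(congr1 (fun m => m%:R : rat)).
rewrite !natrM => <-; have := factr_neq0 a; have := factr_neq0 (N - a).
have : 'C(N, a)%:R != 0 :> rat by rewrite pnatr_eq0 -lt0n bin_gt0 -ltnS.
by move=> h1 h2 h3; field; rewrite h1 h2 h3.
Qed.

(** * Cutting along the root edge *)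

Lemma plant_neq_al (K T : finType) (M : str K T) k l : planted M -> pl M k != al M (pl M l).
Proof.
move=> pM; have [-> |nkl] := eqVneq k l.
  by rewrite eq_sym; case/plantedP: pM => _ nf _ _ _; apply: nf.
by apply: contraTneq (al_face l pM) => <-; rewrite planted_same_face.
Qed.

Lemma pl_eq (K T : finType) (M : str K T) k l : planted M -> (pl M k == pl M l) = (k == l).
Proof.
move=> pM; apply/eqP/eqP => [e|-> //]; apply/eqP.
by rewrite -(planted_same_face _ _ pM) e porbit_id.
Qed.

Section RootEdge.
Local Open Scope group_scope.
Variables K T : finType.
Implicit Type M : str (option K) T.

(** In the notation p, p', h, h' the stub is p' and [root_edge_end] is h'; the trivial case is h =
    p. Products act from left to right, so [cut_root] sends h' to h = alpha(h') and p' to the old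
    successor of h'. *)
Definition stub M := al M (pl M None).
Definition root_edge_end M := al M (ga M (stub M)).
Definition trivial_root M := ga M (stub M) == pl M None.
Definition cut_root M : {perm T} := tperm (stub M) (root_edge_end M) * ga M.

Lemma ga_root M : planted M -> ga M (pl M None) = stub M.
Proof. by case/plantedP => _ _ ->. Qed.

Lemma ga_stub M : planted M -> ga M (stub M) = al M (root_edge_end M).
Proof. by case/plantedP => ->. Qed.

Lemma porbit_stub M : planted M -> porbit (ga M) (stub M) = porbit (ga M) (pl M None).
Proof. by move=> pM; apply/porbit_eqP/al_face. Qed.

Lemma stub_neq_end M : planted M -> ~~ trivial_root M -> stub M != root_edge_end M.
Proof.
move=> pM; apply: contraNneq => e; rewrite /trivial_root ga_stub // -e /stub.
by case/plantedP: pM => ->.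
Qed.

(** Otherwise the plant and the stub would have the same image under gamma. It follows that the cut
    moves no plant. *)
Lemma plant_neq_end M k : planted M -> pl M k != root_edge_end M.
Proof.
move=> pM; have [aK nf gp cov ck] := plantedP _ pM.
apply: contraNneq (plant_neq_al k None pM) => e.
by apply/eqP/(@perm_inj _ (ga M)); rewrite gp e -ga_stub.
Qed.

Lemma cut_root_plant M k : planted M -> cut_root M (pl M k) = al M (pl M k).
Proof.
move=> pM; have [_ _ gp _ _] := plantedP _ pM.
by rewrite permM tpermD ?gp // eq_sym ?plant_neq_al ?plant_neq_end.
Qed.

Lemma cut_root_end M : planted M -> cut_root M (root_edge_end M) = al M (root_edge_end M).
Proof. by move=> pM; rewrite permM tpermR ga_stub. Qed.

(** sigma maps the stub to [root_edge_end], so the transposition acts inside one vertex and splits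
    it. *)
Lemma card_cut_root_si M : planted M -> ~~ trivial_root M ->
  #|porbits (cut_root M * al M)| = #|porbits (si M)|.+1.
Proof.
move=> pM ntM; rewrite -mulgA card_porbits_split ?stub_neq_end //.
by rewrite -/(si M) (_ : root_edge_end M = si M (stub M)) ?mem_porbit_perm // permM.
Qed.

Definition split_root M : str (option (option K)) T :=
  (al M, cut_root M,
   [ffun k => match k with
     | None => pl M None | Some None => root_edge_end M | Some (Some l) => pl M (Some l)
     end]).

(** The transposition is that of [cut_root]: after the split the stub is still the partner of the
    first plant, and h' has become the plant labelled [Some None], so both can be read off the
    result. *)
Definition join_roots (M : str (option (option K)) T) : str (option K) T :=
  (al M, tperm (al M (pl M None)) (pl M (Some None)) * ga M,
   [ffun k => match k with None => pl M None | Some l => pl M (Some (Some l)) end]).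

Lemma split_rootK : cancel split_root join_roots.
Proof.
move=> M; rewrite [RHS]surjective_pairing [M.1]surjective_pairing; congr (_, _, _).
  by rewrite /pl /ga /= !ffunE mulgA tperm2 mul1g.
by apply/ffunP => k; rewrite ffunE; case: k => [l|]; rewrite /pl ffunE.
Qed.

Lemma planted_split_root M : planted M -> ~~ trivial_root M ->
  root_edge_end M \in porbit (ga M) (pl M None) -> planted (split_root M).
Proof.
move=> pM ntM eM; have [aK nf gp cov ck] := plantedP _ pM.
apply/plantedP; split => //.
- move=> k; rewrite /pl ffunE; case: k => [[l|]|]; first exact: cut_root_plant.
    exact: cut_root_end.
  exact: cut_root_plant.
- move=> x; have [k xk] := cov x.
  have cP : stub M \in porbit (cut_root M) (pl M None).
    by rewrite /stub -cut_root_plant // mem_porbit_perm.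
  case/or3P: (porbit_tperm_cover (stub M) (root_edge_end M) xk) => xk'.
  + by case: k xk xk' => [l|] _ xk'; [exists (Some (Some l))|exists None]; rewrite /pl ffunE.
  + by exists None; rewrite /pl ffunE; move/porbit_eqP: cP => <-.
  + by exists (Some None); rewrite /pl ffunE.
- rewrite [LHS]card_porbits_split ?stub_neq_end //; last by rewrite porbit_stub.
  by rewrite ck !card_option.
Qed.

(** The new vertex and the new face cancel in E + k - V. *)
Lemma eta_split_root M : planted M -> ~~ trivial_root M ->
  root_edge_end M \in porbit (ga M) (pl M None) -> eta (split_root M) = eta M.
Proof.
move=> pM ntM eM; rewrite /eta [#|porbits (si (split_root M))|]card_cut_root_si //.
by rewrite [#|porbits (ga (split_root M))|]card_porbits_split ?stub_neq_end ?porbit_stub // addnS subSS.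
Qed.

Section Join.
Variable M : str (option (option K)) T.
Hypothesis pM : planted M.
Let P := pl M None.
Let Q := pl M (Some None).

Lemma stub_join : stub (join_roots M) = al M P.
Proof. by rewrite /stub /pl /= ffunE. Qed.

Lemma end_join : root_edge_end (join_roots M) = Q.
Proof.
have [aK nf gp cov ck] := plantedP _ pM.
by rewrite /root_edge_end stub_join /= permM tpermL /al /= gp aK.
Qed.

Lemma join_rootsK : split_root (join_roots M) = M.
Proof.
rewrite [RHS]surjective_pairing [M.1]surjective_pairing; congr (_, _, _).
  by rewrite /cut_root stub_join end_join mulgA tperm2 mul1g.
apply/ffunP => k; rewrite ffunE; case: k => [[l|]|]; rewrite ?end_join //.
  by rewrite /pl ffunE.
by rewrite /pl ffunE.
Qed.

Let notQ : Q \notin porbit (ga M) (al M P).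
Proof.
have /porbit_eqP -> : al M P \in porbit (ga M) P by apply: al_face.
by rewrite planted_same_face.
Qed.

Let nPQ : al M P != Q.
Proof. by rewrite eq_sym plant_neq_al. Qed.

Lemma ga_join_plant k : k != Some None -> ga (join_roots M) (pl M k) = al M (pl M k).
Proof.
move=> nk; have [aK nf gp cov ck] := plantedP _ pM.
rewrite permM tpermD ?gp // eq_sym ?plant_neq_al //.
apply: contraNneq nk => e; rewrite -(planted_same_face k (Some None) pM) e.
exact: porbit_id.
Qed.

Lemma end_join_face : Q \in porbit (ga (join_roots M)) P.
Proof.
have /porbit_eqP <- : al M P \in porbit (ga (join_roots M)) P.
  by rewrite -ga_join_plant // mem_porbit_perm.
by rewrite porbit_tperm_split.
Qed.

Lemma planted_join : planted (join_roots M).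
Proof.
have [aK nf gp cov ck] := plantedP _ pM.
apply/plantedP; split => //.
- by move=> k; rewrite /pl ffunE; case: k => [l|]; apply: ga_join_plant.
- move=> x; have [k xk] := cov x.
  have aP : al M P \in porbit (ga (join_roots M)) P.
    by rewrite -ga_join_plant // mem_porbit_perm.
  case/or3P: (porbit_tperm_cover (al M P) Q xk) => xk'.
  + case: k xk xk' => [[l|]|] _ xk'.
    * by exists (Some l); rewrite /pl ffunE.
    * exists None; rewrite /pl ffunE; move/porbit_eqP: end_join_face => <- //.
    * by exists None; rewrite /pl ffunE.
  + by exists None; rewrite /pl ffunE; move/porbit_eqP: aP => <-.
  + by exists None; rewrite /pl ffunE; move/porbit_eqP: end_join_face => <-.
- have := card_porbits_merge notQ; rewrite ck !card_option.
  by move=> [<-].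
Qed.

Lemma join_nontrivial : ~~ trivial_root (join_roots M).
Proof.
have [aK nf gp cov ck] := plantedP _ pM.
rewrite /trivial_root (ga_stub planted_join) end_join [pl _ _]ffunE -/P.
by rewrite -(inj_eq (@perm_inj _ (al M))) aK eq_sym nPQ.
Qed.

End Join.

Lemma sum_split_root :
  (\sum_(M | [&& planted M, ~~ trivial_root M & root_edge_end M \in porbit (ga M) (pl M None)])
    'X^(eta M) = gfun (option (option K)) T)%R.
Proof.
rewrite /gfun (reindex_onto split_root join_roots) => [|M' pM']; last exact: join_rootsK.
apply: eq_big => [M|M /and3P[pM ntM eM]]; last by rewrite eta_split_root.
rewrite split_rootK eqxx andbT; apply/and3P/idP => [[pM ntM eM]|pM].
  exact: planted_split_root.
rewrite -(split_rootK M); split; first exact: planted_join.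
  exact: join_nontrivial.
rewrite end_join // [pl (join_roots _) _]ffunE; exact: end_join_face.
Qed.

End RootEdge.

(** * Merging two faces *)

Section MergeFaces.
Local Open Scope group_scope.
Variable T : finType.
Implicit Types (M : str (option unit) T) (U : str unit T).

Definition leaves U : {set T} := [set x | (si U x == x) && (x != pl U tt)].

(** For [y] other than the stub, the cycle of [y] in this product is the stretch of the face from
    just after the stub up to [y]. The test thus says that [x] is met no later than [y] in the walk
    from the stub. *)
Definition after U x y := x \in porbit (tperm (al U (pl U tt)) y * ga U) y.

Definition merge_faces M : str unit T * (T * T) :=
  ((al M, cut_root M, [ffun=> pl M None]), (pl M (Some tt), root_edge_end M)).

Definition unmerge_faces (Z : str unit T * (T * T)) : str (option unit) T :=
  let: (U, (x, y)) := Z in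
  (al U, tperm (al U (pl U tt)) y * ga U, [ffun k => if k is Some _ then x else pl U tt]).

(** This is the image of [merge_faces]: cutting at the second leaf must put the first one on the
    face that is split off, where it serves as plant. *)
Definition marked (Z : str unit T * (T * T)) :=
  [&& planted Z.1, Z.2.1 \in leaves Z.1, Z.2.2 \in leaves Z.1, Z.2.1 != Z.2.2
    & after Z.1 Z.2.1 Z.2.2].

Lemma merge_facesK : cancel merge_faces unmerge_faces.
Proof.
move=> M; rewrite [RHS]surjective_pairing [M.1]surjective_pairing; congr (_, _, _).
  by rewrite /pl /ga /= !ffunE mulgA tperm2 mul1g.
by apply/ffunP => k; rewrite ffunE; case: k => [[]|] //; rewrite /pl ffunE.
Qed.

Lemma unicellular_cover U : planted U -> forall x y, x \in porbit (ga U) y.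
Proof.
move=> /plantedP[_ _ _ cov _] x y; have [[] /porbit_eqP xk] := cov x.
by have [[] /porbit_eqP yk] := cov y; apply/porbit_eqP; rewrite xk yk.
Qed.

Lemma si_fixed K (M : str K T) x : planted M -> (si M x == x) = (ga M x == al M x).
Proof.
case/plantedP => aK _ _ _ _; rewrite permM -(inj_eq (@perm_inj _ (al M))) aK.
by [].
Qed.

(* Two leaves facing each other make up a whole unicellular map. *)
Lemma facing_leaves U z : planted U -> z = al U (pl U tt) -> ga U z = al U z ->
  forall w, w \in [set pl U tt; z].
Proof.
move=> pU zE gz w; have [aK _ gp _ _] := plantedP _ pU.
have := unicellular_cover pU w (pl U tt); move: w; apply: porbit_ind; last by rewrite set21.
by move=> w /set2P[]->; rewrite ?gp ?gz zE ?aK ?set21 ?set22.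
Qed.

Lemma leaf_neq_stub U x : planted U -> (2 < #|T|)%N -> x \in leaves U -> x != al U (pl U tt).
Proof.
move=> pU gtT; rewrite inE si_fixed // => /andP[/eqP gx _]; apply/eqP => e.
have := subset_leq_card (_ : [set: T] \subset [set pl U tt; x]).
rewrite cardsT cards2 => h; have := leq_trans gtT (h _); rewrite ltnNge ltnS.
by case: (_ != _) => /= /(_ (introT subsetP (fun w _ => facing_leaves pU e gx w))).
Qed.

Section Merge.
Variable M : str (option unit) T.
Hypotheses (pM : planted M) (ntM : ~~ trivial_root M).
Hypothesis eM : root_edge_end M \notin porbit (ga M) (pl M None).

Lemma card_merge_faces : #|porbits (cut_root M)| = 1%N.
Proof.
have [_ _ _ _ ck] := plantedP _ pM.
have : root_edge_end M \notin porbit (ga M) (stub M) by rewrite porbit_stub.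
move=> /card_porbits_merge; rewrite ck card_option card_unit => -[<-].
by [].
Qed.

Lemma planted_merge_faces : planted (merge_faces M).1.
Proof.
have [aK nf gp cov ck] := plantedP _ pM.
have cc : #|porbits (ga (merge_faces M).1)| = #|{: unit}| by rewrite card_unit card_merge_faces.
apply/plantedP; split => //.
- by move=> []; rewrite /pl ffunE; apply: cut_root_plant.
- by apply: face_inj_cover => // -[] [].
Qed.

(** The cut adds a vertex and loses a face, so E + k - V drops by two; this is the source of the
    factor X. *)
Lemma eta_merge_faces : eta M = (eta (merge_faces M).1).+1.
Proof.
have [_ _ _ _ ck] := plantedP _ pM.
have := etaE pM; have := etaE planted_merge_faces.
rewrite [#|porbits (si (merge_faces M).1)|]card_cut_root_si //.
rewrite [#|porbits (ga (merge_faces M).1)|]card_merge_faces ck card_option card_unit.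
have -> : al (merge_faces M).1 = al M by [].
by set v := #|porbits (si M)|; set e := #|porbits (al M)|; lia.
Qed.

Lemma marked_merge_faces : marked (merge_faces M).
Proof.
have pU := planted_merge_faces; have [aK nf gp cov ck] := plantedP _ pM.
have plU : pl (merge_faces M).1 tt = pl M None by rewrite /pl ffunE.
rewrite /marked pU /= plant_neq_end // !inE !si_fixed // plU.
have -> : ga (merge_faces M).1 = cut_root M by [].
have -> : al (merge_faces M).1 = al M by [].
rewrite cut_root_plant // cut_root_end // !eqxx /=.
rewrite pl_eq //=.
have -> /= : root_edge_end M != pl M None by rewrite eq_sym plant_neq_end.
rewrite /after plU.
have -> : al (merge_faces M).1 = al M by [].
rewrite [ga _]/(cut_root M) mulgA tperm2 mul1g.
have [[[]|] ek] := cov (root_edge_end M); last by have := eM; rewrite ek.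
by rewrite porbit_sym.
Qed.

End Merge.

Section Unmerge.
Variables (U : str unit T) (x y : T).
Hypothesis mU : marked (U, (x, y)).
Let P := pl U tt.
Let M := unmerge_faces (U, (x, y)).

Let pU : planted U. Proof. by case/and5P: mU. Qed.
Let gx : ga U x = al U x.
Proof. by case/and5P: mU => _; rewrite inE si_fixed // => /andP[/eqP]. Qed.
Let gy : ga U y = al U y.
Proof. by case/and5P: mU => _ _; rewrite inE si_fixed // => /andP[/eqP]. Qed.
Let nxP : x != P.
Proof. by case/and5P: mU => _; rewrite inE => /andP[]. Qed.
Let nyP : y != P.
Proof. by case/and5P: mU => _ _; rewrite inE => /andP[]. Qed.
Let nxy : x != y.
Proof. by case/and5P: mU. Qed.
Let xy : x \in porbit (ga M) y.
Proof. by case/and5P: mU. Qed.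
Let gP : ga U P = al U P.
Proof. by case/plantedP: pU => _ _ ->. Qed.
Let aK : involutive (al U).
Proof. by case/plantedP: pU. Qed.
Let nf z : al U z != z.
Proof. by case/plantedP: pU => _ h _ _ _; apply: h. Qed.

Let gtT : (2 < #|T|)%N.
Proof.
rewrite -cardsT; apply: leq_trans (subset_leq_card (subsetT (x |: (y |: [set P])))).
by rewrite !cardsU1 !cards1 !inE negb_or nxy nxP nyP.
Qed.

Let nxP' : x != al U P. Proof. by case/and5P: mU => _ xL _ _ _; apply: leaf_neq_stub. Qed.
Let nyP' : y != al U P. Proof. by case/and5P: mU => _ _ yL _ _; apply: leaf_neq_stub. Qed.

Let plN : pl M None = P. Proof. by rewrite /pl ffunE. Qed.
Let plS : pl M (Some tt) = x. Proof. by rewrite /pl ffunE. Qed.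
Let stubE : stub M = al U P. Proof. by rewrite /stub plN. Qed.
Let endE : root_edge_end M = y.
Proof. by rewrite /root_edge_end stubE [ga M _]permM tpermL gy [al M _]aK. Qed.

Let gaP : ga M P = al U P.
Proof. by rewrite permM tpermD // eq_sym. Qed.

Let gaX : ga M x = al U x.
Proof. by rewrite permM tpermD // eq_sym // nxy. Qed.

Let stub_face' : al U P \in porbit (ga M) P.
Proof. by rewrite -gaP mem_porbit_perm. Qed.

Lemma end_unmerge : y \notin porbit (ga M) P.
Proof.
move/porbit_eqP: stub_face' => <-; rewrite porbit_tperm_split 1?eq_sym //.
by rewrite negbK unicellular_cover.
Qed.

Lemma planted_unmerge : planted M.
Proof.
have [_ _ _ cov ck] := plantedP _ pU.
have cc : #|porbits (ga M)| = #|{: option unit}|.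
  rewrite [LHS]card_porbits_split 1?eq_sym // ?unicellular_cover //.
  by rewrite ck card_option.
have ne : porbit (ga M) x != porbit (ga M) P.
  by apply: contra end_unmerge => /eqP <-; rewrite porbit_sym.
apply/plantedP; split => //.
- by case=> [[]|]; rewrite ?plN ?plS.
- apply: face_inj_cover => // -[[]|] [[]|] //; rewrite plN plS => e.
    by rewrite e eqxx in ne.
  by rewrite -e eqxx in ne.
Qed.

Lemma unmerge_facesK : merge_faces M = (U, (x, y)).
Proof.
rewrite /merge_faces plS endE; congr (_, _).
rewrite [RHS]surjective_pairing [U.1]surjective_pairing; congr (_, _, _).
  by rewrite /cut_root endE stubE mulgA tperm2 mul1g.
by apply/ffunP => -[]; rewrite ffunE plN.
Qed.

Lemma unmerge_nontrivial : ~~ trivial_root M.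
Proof.
rewrite /trivial_root ga_stub ?planted_unmerge // endE plN.
by apply: contraNneq nyP' => <-; rewrite -[al M y]/(al U y) aK.
Qed.

Lemma unmerge_face : root_edge_end M \notin porbit (ga M) (pl M None).
Proof. by rewrite plN endE end_unmerge. Qed.

End Unmerge.

Lemma sum_merge_faces :
  (\sum_(M : str (option unit) T |
      [&& planted M, ~~ trivial_root M & root_edge_end M \notin porbit (ga M) (pl M None)])
    'X^(eta M) = \sum_(Z | marked Z) 'X^((eta Z.1).+1) :> {poly rat})%R.
Proof.
rewrite [RHS](reindex_onto merge_faces unmerge_faces); last first.
  by move=> [U [x y]]; apply: unmerge_facesK.
apply: eq_big => [M|M /and3P[pM ntM eM]]; last by rewrite eta_merge_faces.
rewrite merge_facesK eqxx andbT; apply/and3P/idP => [[pM ntM eM]|].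
  exact: marked_merge_faces.
case e: (merge_faces M) => [U [x y]] mU.
have -> : M = unmerge_faces (U, (x, y)) by rewrite -e merge_facesK.
by split; [apply: planted_unmerge|apply: unmerge_nontrivial|apply: unmerge_face].
Qed.

(* With [a] the stub, the identity (y x)(a x) = (a x)(a y) reduces both
   membership tests to the cycle type of one product. *)
Lemma after_antisym U x y : planted U -> x != y ->
  x != al U (pl U tt) -> y != al U (pl U tt) -> after U y x = ~~ after U x y.
Proof.
move=> pU nxy nxa nya; rewrite /after; set a := al U (pl U tt) in nxa nya *.
have c1 : #|porbits (ga U)| = 1%N by case/plantedP: pU => _ _ _ _ ->; rewrite card_unit.
pose s := tperm a y * ga U; pose s' := tperm a x * ga U.
have cs : #|porbits s| = 2 by rewrite card_porbits_split 1?eq_sym ?unicellular_cover ?c1.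
have cs' : #|porbits s'| = 2 by rewrite card_porbits_split 1?eq_sym ?unicellular_cover ?c1.
have E : tperm x y * s' = tperm a x * s.
  rewrite !mulgA; congr (_ * _); rewrite conjgC tpermJ tpermR.
  by rewrite tpermD // eq_sym.
rewrite -/s -/s' porbit_sym.
have two : x \notin porbit s a -> x \in porbit s y.
  move=> nx; have := unicellular_cover pU x a.
  move/(porbit_tperm_cover a y); rewrite -/s => /or3P[] //; by rewrite (negbTE nx).
have sep1 : y \notin porbit s a.
  by rewrite porbit_tperm_split 1?eq_sym // negbK unicellular_cover.
(* If both tests held, the product in [E] would have three cycles when computed from [s'] and one
   when computed from [s]; if neither held, one and three. *)
apply/idP/idP => [xy|nxsy].
  apply/negP => xsy; have nxa' : x \notin porbit s a.
    by apply: contra sep1 => /porbit_eqP <-; rewrite porbit_sym.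
  have := card_porbits_merge nxa'; rewrite -E card_porbits_split 1?porbit_sym //.
  by rewrite cs cs'.
apply: contraR nxsy => nxy'; apply: two; apply/negP => xsa.
have := card_porbits_split (_ : a != x) xsa; rewrite -E eq_sym => /(_ nxa).
by have := card_porbits_merge (_ : y \notin porbit s' x); rewrite porbit_sym nxy' cs cs' => /(_ isT) [<-].
Qed.

(** By [after_antisym] exactly one order of each pair of distinct leaves passes the test. The count
    is kept doubled to avoid a division. *)
Lemma card_after U : planted U -> (2 < #|T|)%N ->
  (2 * (\sum_(x in leaves U) \sum_(y in leaves U) ((x != y) && after U x y)) =
   #|leaves U| * #|leaves U|.-1)%N.
Proof.
move=> pU gtT; rewrite mul2n -addnn {2}exchange_big -big_split /=.
rewrite -sum_nat_const; apply: eq_bigr => x xL; rewrite -big_split /=.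
rewrite (eq_bigr (fun y => (y != x) : nat)) => [|y yL].
  rewrite (cardsD1 x) xL /= -sum1_card -big_mkcondr; apply: eq_bigl => y.
  by rewrite in_setD1 andbC.
rewrite eq_sym; have [//|nxy] := eqVneq y x.
rewrite /= (@after_antisym U y x) //; try exact: leaf_neq_stub.
by case: (after _ _ _).
Qed.

Lemma sum_merge_leaves : (2 < #|T|)%N ->
  ((\sum_(M : str (option unit) T |
      [&& planted M, ~~ trivial_root M & root_edge_end M \notin porbit (ga M) (pl M None)])
    'X^(eta M)) *+ 2 =
   \sum_(U | planted U) 'X^((eta U).+1) *+ (#|leaves U| * #|leaves U|.-1) :> {poly rat})%R.
Proof.
move=> gtT; rewrite sum_merge_faces -(pair_big_dep (fun U : str unit T => planted U) (fun U z => [&& z.1 \in leaves U,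
  z.2 \in leaves U, z.1 != z.2 & after U z.1 z.2]) (fun U z => 'X^((eta U).+1))%R) /=.
rewrite -sumrMnl; apply: eq_bigr => U pU.
rewrite sumr_const -mulrnA -card_after // mulnC; congr (_ *+ (_ * _))%R.
rewrite -sum1_card; under [RHS]eq_bigr do rewrite -big_mkcondr.
by rewrite pair_big_dep /=; apply: eq_bigl => z; rewrite -topredE /= andbA.
Qed.

End MergeFaces.

(** * Leaves and trivial components *)

Lemma trivial_root_face (K T : finType) (M : str (option K) T) : planted M -> trivial_root M ->
  porbit (ga M) (pl M None) = [set pl M None; stub M].
Proof.
by move=> pM /eqP tM; rewrite porbit_invol ga_root // tM.
Qed.

Section Leaf.
Local Open Scope group_scope.
Variable T : finType.
Implicit Types (M : str (option unit) T) (U : str unit T).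

(** When the root is trivial, its isolated edge {q, q'} with plant q is inserted into the corner
    after [x]: the face then reads x, q, q', followed by the old successor of x, and q is a leaf. *)
Definition attach_leaf (Z : str (option unit) T * T) : str unit T * T :=
  let: (M, x) := Z in
  ((al M, tperm x (stub M) * ga M, [ffun=> pl M (Some tt)]), pl M None).

Definition detach_leaf (Y : str unit T * T) : str (option unit) T * T :=
  let: (U, q) := Y in let x := (ga U)^-1 q in
  ((al U, tperm x (al U q) * ga U, [ffun k => if k is Some _ then pl U tt else q]), x).

(** The admissible corners: not on the isolated edge itself, and not after the remaining plant,
    which would cease to be a leaf. *)
Definition bare M : {set T} := ~: (pl M None |: (stub M |: [set pl M (Some tt)])).

Lemma card_bare M : planted M -> #|bare M| = (#|T| - 3)%N.
Proof.
move=> pM; rewrite cardsCs setCK !cardsU1 cards1 !inE negb_or.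
rewrite plant_neq_al // [stub M == _]eq_sym plant_neq_al // pl_eq //.
Qed.

Lemma in_bare M x : x \in bare M =
  [&& x != pl M None, x != stub M & x != pl M (Some tt)].
Proof. by rewrite !inE !negb_or. Qed.

Lemma detach_leafK : cancel detach_leaf attach_leaf.
Proof.
move=> [U q]; congr (_, _); last by rewrite /pl ffunE.
rewrite [RHS]surjective_pairing [U.1]surjective_pairing; congr (_, _, _).
  by rewrite /stub /pl /= ffunE mulgA tperm2 mul1g.
by apply/ffunP => -[]; rewrite ffunE /pl ffunE.
Qed.

Section Attach.
Variables (M : str (option unit) T) (x : T).
Hypotheses (pM : planted M) (tM : trivial_root M) (xM : x \in bare M).
Let U := (attach_leaf (M, x)).1.
Let q := pl M None.

Let nxq : x != q. Proof. by case/and3P: (eq_ind _ is_true xM _ (in_bare M x)). Qed.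
Let nxs : x != stub M. Proof. by case/and3P: (eq_ind _ is_true xM _ (in_bare M x)). Qed.
Let nxP : x != pl M (Some tt). Proof. by case/and3P: (eq_ind _ is_true xM _ (in_bare M x)). Qed.

Let stub_sep : stub M \notin porbit (ga M) x.
Proof.
by rewrite porbit_sym porbit_stub // trivial_root_face // !inE negb_or nxq nxs.
Qed.

Lemma card_attach_ga : #|porbits (ga U)|.+1 = #|porbits (ga M)|.
Proof. by rewrite [#|porbits (ga M)|](card_porbits_merge stub_sep). Qed.

Lemma card_attach_si : #|porbits (si U)|.+1 = #|porbits (si M)|.
Proof.
have stub_fix : si M (stub M) = stub M.
  by rewrite permM (eqP tM).
have st : stub M \notin porbit (si M) x.
  apply: contra nxs; rewrite porbit_sym; move: x.
  by apply: porbit_ind => // z /eqP ->; rewrite stub_fix.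
by rewrite [#|porbits (si M)|](card_porbits_merge st) mulgA.
Qed.

(** Attaching merges two faces and two vertices, which cancel in E + k - V. *)
Lemma eta_attach : eta U = eta M.
Proof. by rewrite /eta -card_attach_ga -card_attach_si addnS subSS. Qed.

Lemma planted_attach : planted U.
Proof.
have [aK nf gp cov ck] := plantedP _ pM.
have cc : #|porbits (ga U)| = #|{: unit}|.
  by apply: succn_inj; rewrite card_attach_ga ck card_option.
apply/plantedP; split => //.
- move=> []; rewrite /pl ffunE /= permM tpermD ?gp // eq_sym plant_neq_al //.
- by apply: face_inj_cover => // -[] [].
Qed.

Lemma pl_attach : pl U tt = pl M (Some tt).
Proof. by rewrite /pl ffunE. Qed.

Lemma leaf_attach : q \in leaves U.
Proof.
have [aK nf gp cov ck] := plantedP _ pM.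
rewrite inE si_fixed ?planted_attach // pl_attach.
rewrite permM tpermD ?gp //= ?eqxx //=; first by rewrite pl_eq.
by case/plantedP: pM => _ h _ _ _; apply: h.
Qed.

Lemma attach_leafK : detach_leaf (attach_leaf (M, x)) = (M, x).
Proof.
have [aK nf gp cov ck] := plantedP _ pM.
have xE : (ga U)^-1 q = x.
  by apply: (@perm_inj _ (ga U)); rewrite permKV permM tpermL (eqP tM).
rewrite /detach_leaf /= -/U -/q xE; congr (_, _).
rewrite [RHS]surjective_pairing [M.1]surjective_pairing; congr (_, _, _).
  by rewrite mulgA tperm2 mul1g.
by apply/ffunP => -[[]|]; rewrite ffunE // pl_attach.
Qed.

Definition free_leaves M := [set z in bare M | si M z == z].

(** The vertex of [x] receives the stub, so [x] is no longer a leaf if it was one; all other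
    vertices are untouched. *)
Lemma leaves_attach : leaves U :\ q = free_leaves M :\ x.
Proof.
apply/setP => z; rewrite in_setD1 [in RHS]in_setD1 !inE !negb_or pl_attach.
have siE : si U = tperm x (stub M) * si M by rewrite /si mulgA.
have [->|nzx] := eqVneq z x.
  have -> : si U x = stub M by rewrite siE permM tpermL [LHS]permM (eqP tM).
  by rewrite [stub M == x]eq_sym (negbTE nxs) /= ?andbF.
have [->|nzs] := eqVneq z (stub M).
  have -> : si U (stub M) = si M x by rewrite siE permM tpermR.
  have -> : (si M x == stub M) = false.
    by rewrite permM (inj_eq (@perm_inj _ (al M))) -(eqP tM) (inj_eq (@perm_inj _ (ga M))) (negbTE nxs).
  by rewrite ?andbF.
rewrite siE permM tpermD 1?eq_sym //=.
by rewrite andbCA andbC -!andbA.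
Qed.

End Attach.
Section Detach.
Variables (U : str unit T) (q : T).
Hypotheses (pU : planted U) (qU : q \in leaves U) (gtT : (2 < #|T|)%N).
Let x := (ga U)^-1 q.
Let M := (detach_leaf (U, q)).1.
Let P := pl U tt.

Let gx : ga U x = q. Proof. exact: permKV. Qed.
Let gq : ga U q = al U q.
Proof. by have := qU; rewrite inE si_fixed // => /andP[/eqP]. Qed.
Let nqP : q != P. Proof. by have := qU; rewrite inE => /andP[]. Qed.
Let nqP' : q != al U P. Proof. exact: leaf_neq_stub. Qed.
Let aK : involutive (al U). Proof. by case/plantedP: pU. Qed.
Let nf z : al U z != z. Proof. by case/plantedP: pU => _ h _ _ _; apply: h. Qed.
Let gP : ga U P = al U P. Proof. by case/plantedP: pU => _ _ ->. Qed.

Let nxq : x != q.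
Proof. by apply: contraNneq (nf q) => e; rewrite -gq -{1}e gx. Qed.

Let nxP : x != P.
Proof. by apply: contraNneq nqP' => e; rewrite -gx e gP. Qed.

Let nxq' : x != al U q.
Proof.
apply: contraTneq gtT => e; rewrite -leqNgt -cardsT.
have sub : [set: T] \subset [set q; al U q].
  apply/subsetP => w _; have := unicellular_cover pU w q; move: w.
  apply: porbit_ind; last by rewrite set21.
  by move=> w /set2P[]->; rewrite ?gq ?set22 // -e gx set21.
by apply: leq_trans (subset_leq_card sub) _; rewrite cards2; case: (_ != _).
Qed.

Let nPq' : P != al U q.
Proof. by apply: contraNneq nqP' => ->; rewrite aK. Qed.

Let plN : pl M None = q. Proof. by rewrite /pl ffunE. Qed.
Let plS : pl M (Some tt) = P. Proof. by rewrite /pl ffunE. Qed.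
Let stubE : stub M = al U q. Proof. by rewrite /stub plN. Qed.

Lemma detach_trivial : trivial_root M.
Proof. by rewrite /trivial_root stubE plN [ga M _]permM tpermR gx. Qed.

Lemma planted_detach : planted M.
Proof.
have [_ _ _ _ ck] := plantedP _ pU.
have gMq : ga M q = al U q by rewrite permM tpermD // eq_sym.
have cc : #|porbits (ga M)| = #|{: option unit}|.
  by rewrite card_porbits_split // ?unicellular_cover // ck card_option.
have fq w : w \in porbit (ga M) q -> w \in [set q; al U q].
  by rewrite porbit_invol ?gMq // -stubE (eqP detach_trivial) plN.
have ne : P \notin porbit (ga M) q.
  by apply/negP => /fq /set2P[] /eqP; [rewrite eq_sym (negbTE nqP)|rewrite (negbTE nPq')].
apply/plantedP; split => //.
- by case=> [[]|]; rewrite ?plS ?plN // permM tpermD ?gP // eq_sym.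
- apply: face_inj_cover => // -[[]|] [[]|] //; rewrite plN plS => e.
    by rewrite -e porbit_id in ne.
  by rewrite e porbit_id in ne.
Qed.

Lemma detach_bare : x \in bare M.
Proof. by rewrite in_bare plN plS stubE nxq nxP nxq'. Qed.

End Detach.

(** Plucking a leaf and attaching an isolated edge are inverse bijections. The bound excludes the
    single edge, whose second end could not be plucked. *)
Lemma sum_leaves (V : nmodType) (H : str unit T -> V) : (2 < #|T|)%N ->
  (\sum_(U | planted U) \sum_(q in leaves U) H U =
   \sum_(M | planted M && trivial_root M) \sum_(x in bare M) H (attach_leaf (M, x)).1)%R.
Proof.
move=> gtT; rewrite !pair_big_dep /=.
rewrite (reindex_onto attach_leaf detach_leaf) => [|Y _]; last exact: detach_leafK.
apply: eq_big => [[M x]|[M x] _ //]; apply/andP/andP => [[]|[]].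
  case e: (attach_leaf _) => [U q] /andP[pU qU] /eqP eM.
  have -> : M = (detach_leaf (U, q)).1 by rewrite eM.
  have -> : x = (detach_leaf (U, q)).2 by rewrite eM.
  by rewrite planted_detach // detach_trivial // detach_bare.
move=> /andP[pM tM] xM; rewrite attach_leafK // eqxx; split => //.
by rewrite planted_attach // leaf_attach.
Qed.

Lemma sum_card_leaves : (2 < #|T|)%N ->
  (\sum_(U : str unit T | planted U) 'X^(eta U) *+ #|leaves U| =
   \sum_(M : str (option unit) T | planted M && trivial_root M) 'X^(eta M) *+ (#|T| - 3)
     :> {poly rat})%R.
Proof.
move=> gtT; have := sum_leaves (fun U => 'X^(eta U) : {poly rat})%R gtT.
rewrite (eq_bigr (fun U => 'X^(eta U) *+ #|leaves U|)%R) => [->|U _]; last exact: sumr_const.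
apply: eq_bigr => M /andP[pM tM]; rewrite (eq_bigr (fun _ => 'X^(eta M)%R)) => [|x xM].
  by rewrite sumr_const card_bare.
by rewrite eta_attach.
Qed.

Lemma sum_card_leaf_pairs : (2 < #|T|)%N ->
  (\sum_(U : str unit T | planted U) 'X^(eta U) *+ (#|leaves U| * #|leaves U|.-1) =
   \sum_(M : str (option unit) T | planted M && trivial_root M)
     'X^(eta M) *+ ((#|T| - 4) * #|free_leaves M|) :> {poly rat})%R.
Proof.
move=> gtT; have := sum_leaves (fun U => 'X^(eta U) *+ #|leaves U|.-1 : {poly rat})%R gtT.
rewrite (eq_bigr (fun U => 'X^(eta U) *+ (#|leaves U| * #|leaves U|.-1))%R); last first.
  by move=> U _; rewrite sumr_const -mulrnA mulnC.
move=> ->; apply: eq_bigr => M /andP[pM tM].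
rewrite (eq_bigr (fun x => 'X^(eta M) *+ #|free_leaves M :\ x|)%R) => [|x xM]; last first.
  by rewrite eta_attach // -leaves_attach // (cardsD1 (pl M None)) leaf_attach.
rewrite sumrMnr; congr (_ *+ _)%R.
(* Every free leaf is bare and is missed only when [x] equals it, so the sum of
   [#|free_leaves M :\ x|] is [#|T| - 3 - 1] times the number of free leaves. *)
have : (\sum_(x in bare M) ((x \in free_leaves M) + #|free_leaves M :\ x|) =
        (#|T| - 3) * #|free_leaves M|)%N.
  rewrite -(card_bare pM) -sum_nat_const; apply: eq_bigr => x _.
  by rewrite [RHS](cardsD1 x).
rewrite big_split /= -big_mkcondr /= (eq_bigl (fun x => x \in free_leaves M)) => [|x].
  rewrite sum1_card => e; rewrite (_ : #|T| - 4 = #|T| - 3 - 1)%N; last by lia.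
  by rewrite mulnBl mul1n -e addKn.
by rewrite [x \in free_leaves M]in_set andbA andbb.
Qed.

End Leaf.

(** * Removing an isolated root edge *)

Section TrivialRoot.
Local Open Scope group_scope.
Variables K T : finType.
Implicit Type M : str (option K) T.

Definition flip_bool : {perm bool} := perm (can_inj negbK).

(** The component without (np)-edges. With its plant fixed at [true] nothing is left to choose, so a
    trivial root is determined by the ordered pair of its plant and stub. *)
Definition dipole : str unit bool := (flip_bool, flip_bool, [ffun=> true]).

Lemma dipole_unique (M1 : str unit bool) : planted M1 -> pl M1 tt = true -> M1 = dipole.
Proof.
move=> /plantedP[_ nf gp _ _] p1.
have aE (v : bool) : al M1 v = ~~ v by have := nf v; case: (al M1 v); case: v.
have gT : ga M1 true = false by rewrite -p1 gp p1 aE.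
have gF : ga M1 false = true.
  by case e: (ga M1 false) => //; move: e; rewrite -gT => /perm_inj.
rewrite [LHS]surjective_pairing [M1.1]surjective_pairing; congr (_, _, _).
- by apply/permP => v; rewrite permE -aE.
- by apply/permP => -[]; rewrite permE.
- by apply/ffunP => -[]; rewrite ffunE.
Qed.

Lemma planted_dipole : planted dipole.
Proof.
have cov (v w : bool) : w \in porbit flip_bool v.
  have [->|n] := eqVneq w v; first exact: porbit_id.
  have -> : w = flip_bool v by rewrite permE; move: v w n => [] [].
  exact: mem_porbit_perm.
apply/plantedP; split => //.
- by move=> v; rewrite !permE negbK.
- by move=> []; rewrite permE.
- by move=> v; exists tt.
- rewrite card_unit; apply/eqP/cards1P; exists (porbit flip_bool true).
  apply/setP => A; rewrite inE; apply/imsetP/eqP => [[v _ ->]|->]; last by exists true.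
  exact/porbit_eqP.
Qed.

Lemma eta_dipole : eta dipole = 0%N.
Proof.
have := etaE planted_dipole; have := card_halfedges planted_dipole.
have [_ _ _ _ ->] := plantedP _ planted_dipole; rewrite card_bool card_unit.
have : (0 < #|porbits (si dipole)|)%N.
  by apply/card_gt0P; exists (porbit (si dipole) true); apply: imset_f.
lia.
Qed.

Definition outside (x y : T) := {z : T | z \notin [set x; y]}.

Definition pair_sum (x y : T) (z : bool + outside x y) : T :=
  match z with inl v => if v then x else y | inr u => sval u end.

Definition sum_pair (x y z : T) : bool + outside x y :=
  match boolP (z \in [set x; y]) with
  | AltTrue _ => inl (z == x) | AltFalse h => inr (exist _ z h)
  end.

Lemma pair_sumK x y : x != y -> cancel (@pair_sum x y) (@sum_pair x y).
Proof.
move=> nxy; case=> [v|[z nz]] /=; rewrite /sum_pair; case: {-}_ / boolP => h.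
- by congr inl; case: v {h}; rewrite ?eqxx // eq_sym (negbTE nxy).
- by case/negP: h; case: v; rewrite ?set21 ?set22.
- by case/negP: nz.
- by congr inr; apply: val_inj.
Qed.

Lemma sum_pairK x y : cancel (@sum_pair x y) (@pair_sum x y).
Proof.
move=> z; rewrite /sum_pair; case: {-}_ / boolP => //= /set2P[]->; rewrite ?eqxx //.
by case: eqP.
Qed.

Lemma isl_sum_pair x y z : isl (sum_pair x y z) = (z \in [set x; y]).
Proof. by rewrite /sum_pair; case: {-}_ / boolP => h; rewrite ?h ?(negbTE h). Qed.

Definition add_option (k : unit + K) : option K :=
  match k with inl _ => None | inr l => Some l end.

Definition option_add (k : option K) : unit + K :=
  match k with None => inl tt | Some l => inr l end.

Lemma add_optionK : cancel add_option option_add. Proof. by case=> [[]|]. Qed.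

Lemma option_addK : cancel option_add add_option. Proof. by case. Qed.

Definition add_dipole x y (nxy : x != y) (M : str K (outside x y)) : str (option K) T :=
  glueS option_add (pair_sumK nxy) (@sum_pairK x y) dipole M.

Lemma sum_root_pair (V : nmodType) (G : str (option K) T -> V) x y (nxy : x != y) :
  (\sum_(M | planted M && trivial_root M && ((pl M None, stub M) == (x, y))) G M =
   \sum_(M : str K (outside x y) | planted M) G (add_dipole nxy M))%R.
Proof.
pose gK := pair_sumK nxy; pose gdK := @sum_pairK x y.
pose C M := trivial_root M && ((pl M None, stub M) == (x, y)).
rewrite (eq_bigl (fun M => (planted M && sep option_add (sum_pair x y) M) && C M)); last first.
  move=> M; rewrite /C -[LHS]andbA -[RHS]andbA; apply: andb_id2l => pM.
  case cM: (trivial_root M && _); last by rewrite andbF.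
  rewrite andbT; apply/esym; have /andP[tM /eqP e] := cM.
  have [plx sty] : pl M None = x /\ stub M = y by case: e.
  have [aK nf gp cov ck] := plantedP _ pM.
  have face z : (z \in [set x; y]) = (z \in porbit (ga M) (pl M None)).
    by rewrite trivial_root_face // plx sty.
  apply/and3P; split; apply/forallP => z; rewrite !isl_sum_pair.
  - apply/eqP; apply/idP/idP => /set2P[] e'.
    + by rewrite -(aK z) e' -plx -/(stub M) sty set22.
    + by rewrite -(aK z) e' -sty aK plx set21.
    + by rewrite e' -plx -/(stub M) sty set22.
    + by rewrite e' -sty aK plx set21.
  - by rewrite !face porbit_permr.
  - by rewrite face planted_same_face //; case: z.
rewrite big_mkcondr /= (sum_glue add_optionK option_addK gK gdK).
(* A planted map on [bool] other than [dipole] has its plant at [false], which would put the root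
   plant at [y]. *)
rewrite (bigD1 dipole) ?planted_dipole //= [X in _ + X]big1 ?addr0 => [|M1 /andP[p1 nd]].
  apply: eq_bigr => M pM; rewrite (_ : C _) // /C.
  have plN : pl (glueS option_add gK gdK dipole M) None = x.
    by rewrite (pl_glue_l add_optionK gK gdK dipole M tt) /= ffunE.
  have alx : stub (glueS option_add gK gdK dipole M) = y.
    rewrite /stub plN -[x]/(pair_sum (inl true : bool + outside x y)).
    by rewrite [LHS](glue_l gK gdK) /= permE.
  rewrite /trivial_root alx plN eqxx andbT.
  rewrite -[y in ga _ y]/(pair_sum (inl false : bool + outside x y)).
  by rewrite [X in X == _](glue_l gK gdK) /= permE.
apply: big1 => M pM; case: ifP => // /andP[_ /eqP e].
case/negP: nd; apply/eqP/dipole_unique => //.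
have := congr1 fst e; rewrite /= (pl_glue_l add_optionK gK gdK M1 M tt) /=.
by case: (pl M1 tt) => // yx; have := nxy; rewrite yx eqxx.
Qed.

Lemma eta_add_dipole x y (nxy : x != y) (M : str K (outside x y)) :
  planted M -> eta (add_dipole nxy M) = eta M.
Proof.
move=> pM; rewrite (eta_glue add_optionK option_addK) ?planted_dipole //.
by rewrite eta_dipole.
Qed.

Lemma sum_trivial_root (V : nmodType) (G : str (option K) T -> V) (c : V) :
  (forall x y (nxy : x != y),
    \sum_(M : str K (outside x y) | planted M) G (add_dipole nxy M) = c)%R ->
  (\sum_(M | planted M && trivial_root M) G M = c *+ (#|T| * #|T|.-1))%R.
Proof.
move=> Gc.
rewrite (partition_big (fun M => (pl M None, stub M)) (fun z => z.1 != z.2)) /=; last first.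
  by move=> M /andP[pM _]; rewrite eq_sym; case/plantedP: pM => _ h _ _ _; apply: h.
rewrite (eq_bigr (fun _ => c)) => [|[x y] /= nxy]; last by rewrite (sum_root_pair G nxy).
rewrite sumr_const; congr (_ *+ _)%R.
rewrite -sum1_card -(pair_big_dep predT (fun x y => x != y) (fun _ _ => 1%N)) /=.
rewrite -sum_nat_const; apply: eq_bigr => x _; rewrite sum1_card -(cardC1 x).
by apply: eq_card => y; rewrite !inE eq_sym.
Qed.

Lemma card_outside x y : x != y -> #|{: outside x y}| = (#|T| - 2)%N.
Proof. by move=> nxy; rewrite card_sig -(cardC [set x; y]) cards2 nxy addKn. Qed.

Lemma gfun_trivial_root :
  (\sum_(M : str (option K) T | planted M && trivial_root M) 'X^(eta M) =
   gfun 'I_#|K| 'I_(#|T| - 2) *+ (#|T| * #|T|.-1))%R.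
Proof.
apply: sum_trivial_root => x y nxy.
transitivity (gfun K (outside x y)); first by apply: eq_bigr => M pM; rewrite eta_add_dipole.
by apply: gfun_card; rewrite card_ord // card_outside.
Qed.

End TrivialRoot.

(** * Recursions for the generating functions *)

Lemma card_free_leaves_add_dipole (T : finType) (x y : T) (nxy : x != y)
    (M : str unit (outside x y)) : planted M ->
  #|free_leaves (add_dipole nxy M)| = #|leaves M|.
Proof.
move=> pM; set M' := add_dipole nxy M.
pose h (z : outside x y) : T := pair_sum (inr z).
have plN : pl M' None = x.
  by rewrite (pl_glue_l (@add_optionK _) _ _ dipole M tt) /= ffunE.
have plS : pl M' (Some tt) = h (pl M tt).
  exact: (pl_glue_r (@add_optionK _) (pair_sumK nxy) (@sum_pairK _ x y) dipole M tt).
have stubE : stub M' = y.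
  rewrite /stub plN -[x]/(pair_sum (inl true : bool + outside x y)).
  by rewrite [LHS](glue_l (pair_sumK nxy) (@sum_pairK _ x y)) /= permE.
have siE z : si M' (h z) = h (si M z).
  by rewrite si_glue; apply: glue_r.
rewrite -(card_imset (mem (leaves M)) (val_inj : injective h)); apply: eq_card => z.
apply/setIdP/imsetP => [[]|[w]].
  rewrite in_bare plN plS stubE => /and3P[zx zy zp] /eqP zs.
  have zo : z \notin [set x; y] by rewrite !inE negb_or zx zy.
  exists (exist _ z zo : outside x y) => //; rewrite inE; apply/andP; split.
    by rewrite -(inj_eq (val_inj : injective h)) -siE zs.
  by rewrite -(inj_eq (val_inj : injective h)).
rewrite inE => /andP[/eqP sw nw] ->; rewrite -/(h w) siE sw eqxx; split=> //.
rewrite in_bare plN plS stubE (inj_eq (val_inj : injective h)) nw.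
by have := valP w; rewrite !inE negb_or andbT.
Qed.

Lemma gfun_unit_card_leaves (T : finType) : (2 < #|T|)%N ->
  \sum_(U : str unit T | planted U) 'X^(eta U) *+ #|leaves U| =
  gfun 'I_1 'I_(#|T| - 2) *+ (#|T| * #|T|.-1 * (#|T| - 3)) :> {poly rat}.
Proof.
by move=> gtT; rewrite sum_card_leaves // sumrMnl gfun_trivial_root card_unit -mulrnA.
Qed.

(** [#|T| * #|T|.-1] places the isolated edge, [#|T| - 4] comes from [sum_card_leaf_pairs], and the
    other three factors are the leaf count on the remaining [#|T| - 2] half-edges. *)
Lemma gfun_unit_card_leaf_pairs (T : finType) : (4 < #|T|)%N ->
  \sum_(U : str unit T | planted U) 'X^(eta U) *+ (#|leaves U| * #|leaves U|.-1) =
  gfun 'I_1 'I_(#|T| - 4) *+ ((#|T| - 2) * (#|T| - 3) * (#|T| - 5) * (#|T| - 4) * (#|T| * #|T|.-1))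
    :> {poly rat}.
Proof.
move=> gtT; rewrite sum_card_leaf_pairs; last by lia.
rewrite (mulrnA _ (_ * (#|T| - 4))); apply: sum_trivial_root => x y nxy.
transitivity ((\sum_(M : str unit (outside x y) | planted M) 'X^(eta M) *+ #|leaves M| : {poly rat})
   *+ (#|T| - 4)).
  rewrite -sumrMnl; apply: eq_bigr => M pM.
  by rewrite eta_add_dipole // card_free_leaves_add_dipole // -mulrnA mulnC.
rewrite gfun_unit_card_leaves card_outside //; last by lia.
rewrite -mulrnA; have -> : (#|T| - 2 - 2 = #|T| - 4)%N by lia.
by have -> : ((#|T| - 2) * (#|T| - 2).-1 * (#|T| - 2 - 3) = (#|T| - 2) * (#|T| - 3) * (#|T| - 5))%N by lia.
Qed.

Lemma gfun_root_edge (K T : finType) :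
  gfun (option K) T = gfun 'I_#|K| 'I_(#|T| - 2) *+ (#|T| * #|T|.-1) + gfun (option (option K)) T
  + \sum_(M : str (option K) T |
      [&& planted M, ~~ trivial_root M & root_edge_end M \notin porbit (ga M) (pl M None)])
      'X^(eta M).
Proof.
rewrite -gfun_trivial_root -sum_split_root -addrA [LHS](bigID (@trivial_root K T)) /=; congr (_ + _).
rewrite (bigID (fun M => root_edge_end M \in porbit (ga M) (pl M None))) /=.
by congr (_ + _); apply: eq_bigl => M; rewrite andbA.
Qed.

Lemma planted_card K T (M : str K T) : planted M -> exists m, #|T| = (2 * (m + #|K|))%N.
Proof.
move=> pM; exists (#|porbits (al M)| - #|K|)%N.
by rewrite subnK ?leq_faces_edges // (card_halfedges pM).
Qed.

Lemma gfun_eq0 k N : (forall m, N <> 2 * (m + k))%N -> gfun 'I_k 'I_N = 0.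
Proof.
move=> neN; apply: big_pred0 => M; apply/negP => /planted_card[m].
by rewrite !card_ord; apply: neN.
Qed.

Lemma cgfun_eq0 k N : (forall m, N <> 2 * (m + k))%N -> cgfun 'I_k 'I_N = 0.
Proof.
move=> neN; apply: big_pred0 => M; apply/negP => /andP[/planted_card[m]].
by rewrite !card_ord => /neN.
Qed.

Lemma gfun0 N : gfun 'I_0 'I_N = (N == 0%N)%:R.
Proof.
case: N => [|N] /=.
  pose M0 : str void void := (1%g, 1%g, [ffun k : void => k]).
  rewrite (@gfun_card _ _ void void) ?card_ord ?card_void // /gfun (sum_str_void _ M0).
  by rewrite eta_void ?card_void // expr0.
apply: big_pred0 => M; apply/negP => /plantedP[_ _ _ cov _].
by have [[]] := cov ord0.
Qed.

(** With one face there is nothing to merge. Truncation makes [N - 2 == 0] true also for N = 0 and N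
    = 1, where the factor [N * N.-1] vanishes. *)
Lemma gfun1_cut N : gfun 'I_1 'I_N = (N - 2 == 0)%N%:R *+ (N * N.-1) + gfun 'I_2 'I_N.
Proof.
rewrite (@gfun_card _ _ (option void) 'I_N) ?card_option ?card_void ?card_ord //.
rewrite gfun_root_edge card_void card_ord gfun0 big_pred0 ?addr0 => [|M].
  by congr (_ + _); apply: gfun_card; rewrite ?card_option ?card_void ?card_ord.
apply/negP => /and3P[/plantedP[_ _ _ cov _] _ /negP]; apply.
by have [[[]|]] := cov (root_edge_end M).
Qed.

Lemma gfun2_cut N : (4 < N)%N ->
  gfun 'I_2 'I_N *+ 2 = (gfun 'I_1 'I_(N - 2) *+ (N * N.-1) + gfun 'I_3 'I_N) *+ 2
   + ('X * gfun 'I_1 'I_(N - 4)) *+ ((N - 2) * (N - 3) * (N - 5) * (N - 4) * (N * N.-1)).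
Proof.
move=> gtN; rewrite (@gfun_card _ _ (option unit) 'I_N) ?card_option ?card_unit ?card_ord //.
rewrite gfun_root_edge card_unit card_ord mulrnDl sum_merge_leaves ?card_ord; last by lia.
congr ((_ + _) *+ 2 + _); first by apply: gfun_card; rewrite ?card_option ?card_unit ?card_ord.
have := @gfun_unit_card_leaf_pairs 'I_N; rewrite card_ord => /(_ gtN) => e.
rewrite -mulrnAr -e big_distrr /=; apply: eq_bigr => U _.
by rewrite exprS mulrnAr.
Qed.

Lemma ngfun_gfun k N : gfun 'I_k 'I_N = N`!%:R *: ngfun k N.
Proof. by rewrite /ngfun scalerA mulfV ?factr_neq0 // scale1r. Qed.

Lemma ngfun1_cut N : (2 < N)%N -> ngfun 1 N = ngfun 2 N.
Proof.
move=> gtN; rewrite /ngfun gfun1_cut (_ : (N - 2 == 0)%N = false) ?mul0rn ?add0r //; lia.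
Qed.

Lemma ngfun1_edge : ngfun 1 2 = 1.
Proof.
rewrite /ngfun gfun1_cut gfun_eq0 ?addr0 => [|m]; last by lia.
by rewrite -scaler_nat scalerA mulVf ?scale1r // pnatr_eq0.
Qed.

Lemma ngfun2_cut N : (4 < N)%N ->
  ngfun 2 N *+ 2 = (ngfun 1 (N - 2) + ngfun 3 N) *+ 2
   + ('X * ngfun 1 (N - 4)) *+ ((N - 5) * (N - 4)).
Proof.
move=> gtN; have f0 := factr_neq0 N.
have N2 : (N * N.-1 * (N - 2)`! = N`!)%N.
  by case: N gtN {f0} => [|[|N]] // _; rewrite !factS mulnA subSS subSS subn0.
have N4 : ((N - 2) * (N - 3) * (N * N.-1) * (N - 4)`! = N`!)%N.
  rewrite -N2; case: N gtN {N2 f0} => [|[|[|[|N]]]] // _.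
  by rewrite !subSS !subn0 !factS /=; lia.
have s2 (p : {poly rat}) : ((N - 2)`!%:R *: p) *+ (N * N.-1) = N`!%:R *: p.
  by rewrite -scaler_nat scalerA -natrM N2.
have s4 (p : {poly rat}) : ('X * ((N - 4)`!%:R *: p)) *+
    ((N - 2) * (N - 3) * (N - 5) * (N - 4) * (N * N.-1)) =
    N`!%:R *: (('X * p) *+ ((N - 5) * (N - 4))).
  rewrite -scalerAr -scaler_nat scalerA -natrM -scalerMnr -[RHS]scaler_nat scalerA -natrM -N4.
  by congr (_%:R *: _); lia.
apply: (scalerI f0); rewrite -[LHS]scalerMnr -ngfun_gfun gfun2_cut //.
rewrite [RHS]scalerDr -[X in _ = X + _]scalerMnr [X in _ = X *+ _ + _]scalerDr.
by rewrite !ngfun_gfun s2 s4.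
Qed.

Lemma connected_face1 T (M : str 'I_1 T) : planted M -> connected M.
Proof.
move=> /plantedP[_ _ _ cov _]; rewrite (connectedP M ord0); apply/forallP => x.
have [k] := cov x; rewrite (_ : k = ord0); last by apply: val_inj; case: k => -[].
exact: joined_porbit_l.
Qed.

Lemma ncgfun1 N : ncgfun 1 N = ngfun 1 N.
Proof.
rewrite /ncgfun /ngfun; congr (_ *: _); apply: eq_bigl => M.
by apply: andb_idr; apply: connected_face1.
Qed.

Lemma sum_even_conv (R : nzRingType) (f h : nat -> R) j l n :
  (forall a, (forall m, a <> 2 * (m + j))%N -> f a = 0) ->
  (forall a, (forall m, a <> 2 * (m + l))%N -> h a = 0) ->
  \sum_(a < (2 * (n + j + l)).+1) f a * h (2 * (n + j + l) - a)%N =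
  \sum_(m < n.+1) f (2 * (m + j))%N * h (2 * (n - m + l))%N.
Proof.
move=> f0 h0; pose e (m : 'I_n.+1) : 'I_(2 * (n + j + l)).+1 := inord (2 * (m + j)).
have eE m : e m = (2 * (m + j))%N :> nat by rewrite inordK //; have := ltn_ord m; lia.
rewrite (bigID (fun a => a \in [set e m | m in 'I_n.+1])) /= [X in _ + X]big1 ?addr0 => [|a na].
  rewrite big_imset => [|m m' _ _ /(congr1 val)]; last by rewrite /= !eE => h1; apply: val_inj => /=; lia.
  apply: eq_bigr => m _; rewrite eE; congr (_ * h _); have := ltn_ord m; lia.
(* An index outside the image either has the wrong form for [f], or has it with m > n; then the
   complementary index is too small for [h]. *)
have [/existsP[m /eqP am]|] := boolP [exists m : 'I_(n + l).+1, a == (2 * (m + j))%N :> nat].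
  rewrite [h _]h0 ?mulr0 // => m' e'; case/negP: na; apply/imsetP.
  have lt : (m < n.+1)%N by have := ltn_ord m; lia.
  by exists (Ordinal lt) => //; apply: val_inj; rewrite [RHS]eE.
rewrite negb_exists => /forallP na'; rewrite f0 ?mul0r // => m am.
have lt : (m < (n + l).+1)%N by have := ltn_ord a; lia.
by have := na' (Ordinal lt); rewrite /= am eqxx.
Qed.

(** * Isomorphism classes *)

Section Classes.
Local Open Scope group_scope.
Variables N k : nat.
Implicit Types M : MD N k.

Lemma planted_cellularE M : planted_cellular M = planted (M : str 'I_k 'I_N).
Proof.
apply/idP/plantedP.
  move=> /andP[/andP[/andP[/andP[/forallP i /forallP nf] /eqP c] /forallP d] /forallP s].
  have aK : involutive (al M) by move=> x; apply/eqP/i.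
  split=> //; last by rewrite card_ord.
    by move=> j; apply: (inv_inj aK); rewrite aK -permM; apply/eqP/s.
  apply: face_inj_cover; last by rewrite card_ord.
  by move=> j l /eqP; apply: contraTeq => njl; have /forallP/(_ l)/implyP := d j; apply.
move=> pM; have pM' : planted (M : str 'I_k 'I_N) by apply/plantedP.
have [aK nf gp cov ck] := pM.
apply/andP; split; last by apply/forallP => j; apply/eqP/(si_plant j pM').
apply/andP; split; last first.
  apply/forallP => j; apply/forallP => l; apply/implyP; apply: contraNneq => e.
  by apply/eqP; apply: (planted_face_inj pM').
rewrite -[mgamma M]/(ga M) ck card_ord eqxx andbT.
by apply/andP; split; apply/forallP => x; rewrite -[malpha M]/(al M) ?aK.
Qed.

(** gamma = alpha o sigma, so alpha generates the same group with either of gamma and sigma. *)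
Lemma mconnectedE M : planted (M : str 'I_k 'I_N) -> mconnected M = connected M.
Proof.
case/plantedP => aK _ _ _ _.
have gaE z : ga M z = al M (si M z) by rewrite permM aK.
apply: eq_forallb => x; apply: eq_forallb => y; apply/idP/idP.
  move: y; apply: joined_ind => [z xz|z xz|]; last exact: connect0.
    by rewrite permM; apply: joined_trans xz (joined_trans (joined_l _ _ _) (joined_r _ _ _)).
  exact: joined_trans xz (joined_r _ _ _).
move: y; apply: joined_ind => [z xz|z xz|]; last exact: connect0.
  rewrite gaE; apply: connect_trans xz _.
  exact: (@joined_trans _ (si M) (al M) _ _ _ (joined_l _ _ _) (joined_r _ _ _)).
exact: connect_trans xz (joined_r (si M) (al M) _).
Qed.

Lemma n_np_edgesE M : planted (M : str 'I_k 'I_N) ->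
  n_np_edges M = (#|porbits (al M)| - k)%N.
Proof.
by move=> pM; rewrite /n_np_edges (card_imset _ (plant_edge_inj pM)) card_ord.
Qed.

Lemma has_genusE M g : planted (M : str 'I_k 'I_N) -> (0 < k)%N ->
  has_genus M g = (eta M == g + k.-1)%N.
Proof.
move=> pM k0; have [_ _ _ _ ck] := plantedP _ pM; have := etaE pM; rewrite ck card_ord.
rewrite /has_genus /nverts /nedges.
rewrite -[porbits (si M)]/(porbits (msigma M)) -[porbits (al M)]/(porbits (malpha M)).
move: #|_| #|_| (eta M) => V E h e; apply/eqP/eqP; lia.
Qed.

Lemma good_card g n M : good g n M -> N = (2 * (n + k))%N.
Proof.
move=> /and4P[]; rewrite planted_cellularE => pM _ _; rewrite n_np_edgesE // => /eqP <-.
by rewrite subnK -?(card_halfedges pM) ?card_ord // -{1}(card_ord k) leq_faces_edges.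
Qed.

Lemma goodE g n M : (0 < k)%N -> N = (2 * (n + k))%N ->
  good g n M = [&& planted (M : str 'I_k 'I_N), connected M & eta M == g + k.-1]%N.
Proof.
move=> k0 NE; rewrite /good planted_cellularE; apply: andb_id2l => pM.
rewrite mconnectedE // has_genusE // n_np_edgesE //; congr (_ && _).
have := card_halfedges pM; rewrite card_ord => e.
move: #|_| e => E e; rewrite (_ : E - k = n)%N ?eqxx ?andbT //; lia.
Qed.

Definition relabel (phi : {perm 'I_N}) M : MD N k :=
  (malpha M ^ phi, mgamma M ^ phi, [ffun i => phi (mplant M i)]).

Lemma relabelM phi psi M : relabel psi (relabel phi M) = relabel (phi * psi) M.
Proof.
rewrite /relabel; congr (_, _, _); rewrite ?conjgM //.
by apply/ffunP => i; rewrite !ffunE permM.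
Qed.

Lemma relabel1 M : relabel 1 M = M.
Proof.
case: M => [[a c] p]; rewrite /relabel /malpha /mgamma /= !conjg1; congr (_, _, _).
by apply/ffunP => i; rewrite ffunE perm1.
Qed.

Lemma isoP M M' : reflect (exists phi, M' = relabel phi M) (iso M M').
Proof.
apply: (iffP existsP) => -[phi].
  move=> /andP[/andP[/forallP ha /forallP hg] /forallP hp]; exists phi.
  rewrite [M']surjective_pairing [M'.1]surjective_pairing; congr (_, _, _).
  - by apply/permP => x; rewrite -[x](permKV phi) permJ (eqP (ha _)).
  - by apply/permP => x; rewrite -[x](permKV phi) permJ (eqP (hg _)).
  - by apply/ffunP => i; rewrite ffunE (eqP (hp _)).
move=> ->; exists phi; apply/andP; split; first apply/andP; first split; apply/forallP => x.
- by rewrite permJ.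
- by rewrite permJ.
- by rewrite ffunE.
Qed.

Lemma iso_equivalence : equivalence_rel (@iso N k).
Proof.
move=> M M' M''; split; first by apply/isoP; exists 1; rewrite relabel1.
move=> /isoP[phi ->]; apply/isoP/isoP => -[psi ->].
  by exists (phi^-1 * psi); rewrite relabelM mulgA mulgV mul1g.
by exists (phi * psi); rewrite relabelM.
Qed.

Lemma relabel_glue phi M : exists (fd : 'I_k -> 'I_k + void) (g : 'I_N + void -> 'I_N)
    (gd : 'I_N -> 'I_N + void) (gK : cancel g gd) (gdK : cancel gd g) (M0 : str void void),
  (exists2 f : 'I_k + void -> 'I_k, cancel f fd & cancel fd f) /\
  relabel phi M = glueS fd gK gdK (M : str 'I_k 'I_N) M0.
Proof.
pose g (z : 'I_N + void) := match z with inl x => phi x | inr v => match v with end end.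
pose gd x : 'I_N + void := inl (phi^-1 x).
have gK : cancel g gd by case=> [x|[]]; rewrite /gd /= permK.
have gdK : cancel gd g by move=> x; rewrite /gd /= permKV.
exists (@inl _ _), g, gd, gK, gdK, (1, 1, [ffun v : void => v]); split.
  by exists (fun z : 'I_k + void => match z with inl x => x | inr v => match v with end end) => // -[|[]].
rewrite /relabel /glueS; congr (_, _, _).
- apply/permP => x; rewrite -[x](permKV phi) permJ -[phi (_ x)]/(g (inl (phi^-1 x))).
  by rewrite (glue_l gK gdK).
- apply/permP => x; rewrite -[x](permKV phi) permJ -[phi (_ x)]/(g (inl (phi^-1 x))).
  by rewrite (glue_l gK gdK).
Qed.

Lemma good_relabel g n phi M : (0 < k)%N -> good g n M -> good g n (relabel phi M).
Proof.
move=> k0 gM; have NE := good_card gM; move: gM; rewrite !goodE // => /and3P[pM cM eM].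
have [fd [h [hd [hK [hdK [M0 [[f fK fdK] ->]]]]]]] := relabel_glue phi M.
have p0 : planted M0 by rewrite planted_void ?card_void.
rewrite (planted_glue fK fdK) pM p0 connected_glue_void cM.
by rewrite (eta_glue fK fdK) // (eta_void M0) ?card_void // addn0 eM.
Qed.

Lemma relabel_inj g n M : (0 < k)%N -> good g n M -> injective (relabel^~ M).
Proof.
move=> k0 gM phi psi [ea eg ep]; have NE := good_card gM.
move: gM; rewrite goodE // => /and3P[pM cM _].
pose i0 := Ordinal k0; apply/permP => x; apply/eqP.
have := forallP (forallP cM (pl M i0)) x; move: x.
apply: (@joined_ind _ _ _ (fun x => phi x == psi x)) => [z /eqP e|z /eqP e|].
- by rewrite -(permJ (ga M) phi) -(permJ (ga M) psi) e -[ga M]/(mgamma M) eg.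
- by rewrite -(permJ (al M) phi) -(permJ (al M) psi) e -[al M]/(malpha M) ea.
- by move/ffunP/(_ i0): ep; rewrite !ffunE => ->.
Qed.

Lemma card_classes g n : (0 < k)%N ->
  (#|Defs.classes N k g n| * N`! = #|[set M : MD N k | good g n M]|)%N.
Proof.
move=> k0; pose D := [set M : MD N k | good g n M].
(* The given classes are taken among all triples, the partition only inside [D]; they agree because
   [good] is invariant under isomorphism. *)
have cE : Defs.classes N k g n = equivalence_partition (@iso N k) D.
  apply: eq_in_imset => M; rewrite inE => gM; apply/setP => M'; rewrite !inE.
  case iM : (iso M M'); last by rewrite andbF.
  by have /isoP[phi ->] := iM; rewrite good_relabel.
rewrite -/D -(@card_uniform_partition _ N`! (Defs.classes N k g n) D) //; last first.
  by rewrite cE; apply: equivalence_partitionP => M M' M'' _ _ _; apply: iso_equivalence.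
move=> A /imsetP[M]; rewrite inE => gM ->.
rewrite -[RHS](card_Sn N) -[in RHS](card_imset predT (relabel_inj k0 gM)).
apply: eq_card => M'; rewrite inE; apply/isoP/imsetP => [[phi ->]|[phi _ ->]]; by exists phi.
Qed.

End Classes.

Lemma coef_ncgfun_count k g n : (0 < k)%N ->
  (ncgfun k (2 * (n + k)))`_(g + k.-1) = (count_maps k g n)%:R.
Proof.
move=> k0; rewrite /count_maps big_ord_recr big1 => [|i _] /=; last first.
  rewrite /Defs.classes (_ : [set M : MD i k | good g n M] = set0) ?imset0 ?cards0 //.
  apply/setP => M; rewrite !inE; apply/negP => /good_card e.
  by have := ltn_ord i; rewrite {1}e ltnn.
rewrite add0n /ncgfun coefZ /cgfun coef_sum; set N := (2 * (n + k))%N.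
rewrite (eq_bigr (fun M : str 'I_k 'I_N => (eta M == g + k.-1)%N%:R)) => [|M _]; last first.
  by rewrite coefXn eq_sym.
rewrite -natr_sum; apply: (mulfI (factr_neq0 N)).
rewrite mulrA mulfV ?factr_neq0 // mul1r -natrM; congr _%:R.
rewrite mulnC (@card_classes N k g n k0) -sum1dep_card -big_mkcondr.
by apply: eq_bigl => M; rewrite /= goodE // andbA.
Qed.

Lemma coef_ncgfun_small k N e : (e < k.-1)%N -> (ncgfun k N)`_e = 0.
Proof.
move=> ek; rewrite /ncgfun coefZ /cgfun coef_sum big1 ?mulr0 // => M /andP[pM cM].
have := eta_connected pM cM; rewrite card_ord coefXn => h.
by rewrite (_ : (e == eta M) = false) //; apply/eqP; lia.
Qed.

(** * The recursion *)

Definition upoly (n : nat) : {poly rat} := ncgfun 1 (2 * (n + 1)).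
Definition bpoly (n : nat) : {poly rat} := ncgfun 2 (2 * (n + 2)).
Definition tpoly (n : nat) : {poly rat} := ncgfun 3 (2 * (n + 3)).

Lemma coef_upoly n g : (upoly n)`_g = (u g n)%:R.
Proof. by rewrite -[g in LHS]addn0 -coef_ncgfun_count. Qed.

Lemma coef_bpoly n g : (bpoly n)`_g.+1 = (b g n)%:R.
Proof. by rewrite -addn1 -coef_ncgfun_count. Qed.

Lemma coef_bpoly0 n : (bpoly n)`_0 = 0.
Proof. exact: coef_ncgfun_small. Qed.

Lemma coef_tpoly n g : (tpoly n)`_g.+2 = (t g n)%:R.
Proof. by rewrite -addn2 -coef_ncgfun_count. Qed.

Lemma upoly0 : upoly 0 = 1.
Proof. by rewrite /upoly ncgfun1 ngfun1_edge. Qed.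

Lemma ngfun_eq0 k a : (forall m, a <> 2 * (m + k))%N -> ngfun k a = 0.
Proof. by move=> h; rewrite /ngfun gfun_eq0 ?scaler0. Qed.

Lemma ncgfun_eq0 k a : (forall m, a <> 2 * (m + k))%N -> ncgfun k a = 0.
Proof. by move=> h; rewrite /ncgfun cgfun_eq0 ?scaler0. Qed.

Lemma sum_ngfun0 (F : nat -> {poly rat}) N :
  \sum_(a < N.+1) F a * ngfun 0 (N - a) = F N.
Proof.
rewrite big_ord_recr /= big1 ?add0r => [|i _].
  by rewrite subnn /ngfun gfun0 fact0 invr1 scale1r mulr1.
by rewrite /ngfun gfun0 subn_eq0 leqNgt ltn_ord scaler0 mulr0.
Qed.

Lemma ngfun2E n :
  ngfun 2 (2 * (n + 2)) = bpoly n + \sum_(m < n.+1) upoly m * upoly (n - m).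
Proof.
rewrite ngfun_decompose.
under eq_bigr do rewrite big_ord_recr big_ord1 /= subn0 bin0 binn !mulr1n.
rewrite big_split /= addrC sum_ngfun0 -/(bpoly n); congr (_ + _).
rewrite (_ : n + 2 = n + 1 + 1)%N; last by lia.
rewrite (sum_even_conv (j := 1) (l := 1) (f := ncgfun 1) (h := ngfun 1)).
- by apply: eq_bigr => m _; rewrite /upoly -!ncgfun1.
- exact: ncgfun_eq0.
- exact: ngfun_eq0.
Qed.

Lemma upolyS n : upoly n.+1 = ngfun 2 (2 * (n + 2)).
Proof. by rewrite /upoly ncgfun1 addn1 addn2 ngfun1_cut //; lia. Qed.

(** The component of face 0 has three, two or one faces. In the last case the other two faces form a
    possibly disconnected map, whose count is again U shifted by one. *)
Lemma ngfun3E n :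
  ngfun 3 (2 * (n + 3)) = tpoly n + (\sum_(m < n.+1) bpoly m * upoly (n - m)) *+ 2
    + \sum_(m < n.+1) upoly m * upoly (n - m).+1.
Proof.
rewrite ngfun_decompose.
under eq_bigr do rewrite !big_ord_recr big_ord0 /= subn0 add0r bin0 bin1 binn !mulr1n.
rewrite !big_split /= sum_ngfun0 -/(tpoly n) addrC -[RHS]addrA; congr (_ + _).
rewrite addrC -mulr2n; congr (_ *+ 2 + _).
- rewrite (_ : n + 3 = n + 2 + 1)%N; last by lia.
  rewrite (sum_even_conv (j := 2) (l := 1) (f := ncgfun 2) (h := ngfun 1)).
  + by apply: eq_bigr => m _; rewrite /upoly -!ncgfun1.
  + exact: ncgfun_eq0.
  + exact: ngfun_eq0.
- rewrite (_ : n + 3 = n + 1 + 2)%N; last by lia.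
  rewrite (sum_even_conv (j := 1) (l := 2) (f := ncgfun 1) (h := ngfun 2)).
  + by apply: eq_bigr => m _; rewrite upolyS.
  + exact: ncgfun_eq0.
  + exact: ngfun_eq0.
Qed.

Lemma upolySS n : upoly n.+2 = upoly n.+1 + ngfun 3 (2 * (n + 3))
  + ('X * upoly n) *+ (n.+1 * (2 * n).+1).
Proof.
have h2 : injective (fun p : {poly rat} => p *+ 2).
  by move=> p q /polyP e; apply/polyP => i; have := e i; rewrite !coefMn => /(@pmulrnI _ 2 isT).
apply: h2 => /=; rewrite upolyS (_ : n.+1 + 2 = n + 3)%N; last by lia.
rewrite ngfun2_cut; last by lia.
rewrite [RHS]mulrnDl /upoly !ncgfun1 -[RHS]/(_ + _) -mulrnA.
by congr ((ngfun 1 _ + _) *+ 2 + ('X * ngfun 1 _) *+ _); lia.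
Qed.

(** As [upoly 0] is 1, the only map with n = 0 is the single edge, and the subtraction removes
    exactly it. *)
Definition uspoly (n : nat) : {poly rat} := upoly n - (n == 0%N)%:R.

Lemma coef_uspoly n g : (uspoly n)`_g = (ustar g n)%:R.
Proof.
rewrite /uspoly coefB coef_upoly /ustar; case: n => [|n] /=; last first.
  by rewrite coef0 subr0 andbF.
rewrite coef1 andbT -coef_upoly upoly0 coef1; case: g => [|g] /=; first by rewrite subrr.
by rewrite subr0 -coef_upoly upoly0 coef1.
Qed.

Definition dpoly n : {poly rat} :=
  (\sum_(m < n.+1) uspoly m * bpoly (n - m)) *+ 3
  + \sum_(m1 < n.+1) uspoly m1 * \sum_(m2 < (n - m1).+1) uspoly m2 * uspoly (n - m1 - m2).

Lemma coef_dpoly g n : (dpoly n)`_g.+2 = (d2 g n)%:R.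
Proof.
rewrite /dpoly coefD coefMn !coef_sum /d2 natrD natrM mulr_natl; congr (_ *+ 3 + _).
  rewrite exchange_big /= natr_sum; apply: eq_bigr => m _.
  (* A bicellular map of genus g' sits in degree g' + 1, so the last term of the convolution meets
     the vanishing constant coefficient of [bpoly], and g1 stops at g + 1. *)
  rewrite coefM big_ord_recr /= subnn coef_bpoly0 mulr0 addr0 natr_sum.
  apply: eq_bigr => j _; rewrite coef_uspoly natrM.
  have := ltn_ord j; rewrite ltnS => lj; rewrite subSn // coef_bpoly //.
under eq_bigr do rewrite coefM.
rewrite exchange_big /= natr_sum; apply: eq_bigr => g1 _.
have lg : (g1 <= g.+2)%N by rewrite -ltnS.
rewrite (subSn lg).
under eq_bigr do rewrite coef_sum big_distrr /=.
under eq_bigr do under eq_bigr do rewrite coefM big_distrr /=.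
under eq_bigr do rewrite exchange_big.
rewrite exchange_big natr_sum; apply: eq_bigr => g2 _.
rewrite natr_sum; apply: eq_bigr => m1 _.
have lm : (m1 <= n)%N by rewrite -ltnS.
rewrite (subSn lm) natr_sum; apply: eq_bigr => m2 _.
by rewrite !coef_uspoly -!natrM mulnA.
Qed.

(** Coefficient extraction from polynomials truncated at degree n, up to which [UU] holds.
    Substituting S - B for U^2 turns the cubic term into US - UB and -3B - 3U^2 into -3S. *)
Lemma dpolyE n : dpoly n = (\sum_(m < n.+1) bpoly m * upoly (n - m)) *+ 2
  + \sum_(m < n.+1) upoly m * upoly (n - m).+1
  - upoly n.+1 *+ 3 + upoly n *+ 3 - (n == 0%N)%:R.
Proof.
pose U : {poly {poly rat}} := \poly_(m < n.+1) upoly m.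
pose B : {poly {poly rat}} := \poly_(m < n.+1) bpoly m.
pose S : {poly {poly rat}} := \poly_(m < n.+1) upoly m.+1.
have cU m : (m <= n)%N -> U`_m = upoly m by move=> lm; rewrite coef_poly ltnS lm.
have cB m : (m <= n)%N -> B`_m = bpoly m by move=> lm; rewrite coef_poly ltnS lm.
have cS m : (m <= n)%N -> S`_m = upoly m.+1 by move=> lm; rewrite coef_poly ltnS lm.
have cU1 m : (m <= n)%N -> (U - 1)`_m = uspoly m by move=> lm; rewrite coefB cU // coef1.
have le m (i : 'I_m.+1) : (i <= m)%N by rewrite -ltnS.
have UU m : (m <= n)%N -> (U * U)`_m = (S - B)`_m.
  move=> lm; rewrite coefM coefB cS // cB // upolyS ngfun2E [bpoly m + _]addrC addrK.
  apply: eq_bigr => i _; rewrite !cU //; first by rewrite (leq_trans (leq_subr _ _)).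
  exact: leq_trans (le _ i) lm.
have UUU : (U * (U * U))`_n = (U * (S - B))`_n.
  by rewrite !coefM; apply: eq_bigr => i _; rewrite UU // leq_subr.
have -> : dpoly n = ((U - 1) * B *+ 3 + (U - 1) * ((U - 1) * (U - 1)))`_n.
  rewrite coefD coefMn !coefM /dpoly; congr (_ *+ 3 + _); apply: eq_bigr => i _.
    by rewrite cU1 // cB // leq_subr.
  rewrite cU1 //; congr (_ * _); rewrite coefM; apply: eq_bigr => j _.
  have lj := le _ j; rewrite !cU1 //; first by lia.
  by apply: leq_trans lj (leq_subr _ _).
have -> : (\sum_(m < n.+1) bpoly m * upoly (n - m)) = (B * U)`_n.
  by rewrite coefM; apply: eq_bigr => i _; rewrite cU ?leq_subr // cB.
have -> : (\sum_(m < n.+1) upoly m * upoly (n - m).+1) = (U * S)`_n.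
  by rewrite coefM; apply: eq_bigr => i _; rewrite cS ?leq_subr // cU.
have -> : (U - 1) * B *+ 3 + (U - 1) * ((U - 1) * (U - 1)) =
   U * (U * U) + (U * B - B - U * U + U) *+ 3 - 1 by ring.
rewrite coefB coef1 coefD UUU coefMn 3!coefD !coefN UU // cU // cB //.
rewrite (_ : U * (S - B) = U * S - U * B) ?mulrBr // !coefB cS // cB // [B * U]mulrC.
by case: (n == 0%N); ring.
Qed.

Theorem theorem5p6 (g n : nat) :
  (u g.+2 n.+2)%:Z =
    (t g n)%:Z + (d2 g n)%:Z + 4%:Z * (u g.+2 n.+1)%:Z - 3%:Z * (u g.+2 n)%:Z
    + ((n.+1 * (2 * n).+1)%N)%:Z * (u g.+1 n)%:Z.
Proof.
have := congr1 (fun p : {poly rat} => p`_g.+2) (upolySS n); rewrite ngfun3E /=.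
move: (dpoly n) (dpolyE n) (coef_dpoly g n) => p pE cp.
(* The products of [bpoly] and [upoly] are traded for [dpoly]. The correction at n = 0 is a constant
   polynomial, invisible in degree g + 2. *)
rewrite (_ : _ + _ *+ 2 + _ = tpoly n + (p + upoly n.+1 *+ 3 - upoly n *+ 3
  + (n == 0%N)%:R)); last by rewrite pE; ring.
rewrite !coefD coefN !coefMn coefXM coef1 mul0rn cp coef_tpoly !coef_upoly /= => E.
move: (u g.+2 n.+2) (u g.+2 n.+1) (u g.+2 n) (u g.+1 n) (t g n) (d2 g n) E => v0 v1 v2 v3 v4 v5 E.
apply: (@intr_inj rat); rewrite !(rmorphD, rmorphN, rmorphM) /= -!pmulrn E.
by rewrite -[_ *+ (_ * _)]mulr_natl natrM; ring.
Qed.
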